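(* Let $\{S_i\}_{i\in\mathcal I}$ be a finite family of contracting similarities of $\mathbb{R}^d$, $S_i(x)=c_iM_i(x)+b_i$, let $C\subset\mathbb{R}^d$ be non-empty and compact, and let $F_C$ be the inhomogeneous attractor. With $s,\alpha,\beta,\gamma$ as in the context, \[ \overline{\dim}_{\mathrm B}F_C\le\max_{0\le x\le1}\min\Big\{xs+(1-x)\beta,\ x\alpha+(1-x)d,\ \alpha+(1-x)(\beta+d-1),\ \alpha+x\gamma+(1-x)\beta\Big\}. \]
   Context: Here $c_i\in(0,1)$, $M_i$ orthogonal, $b_i\in\mathbb{R}^d$; $T_i(x)=c_iM_i(x)$. $F_C$ is the unique non-empty compact set with $F_C=\bigcup_iS_i(F_C)\cup C$, and $F_\emptyset$ the unique non-empty compact set with $F_\emptyset=\bigcup_iS_i(F_\emptyset)$. $\mathcal I^*$ is the set of finite non-empty words over $\mathcal I$; $T_I$ and $c_I$ denote compositions and products along a word; $\mathcal I_k=\{I\in\mathcal I^*:2^{-k-1}<c_I\le2^{-k}\}$. $s$ is the unique $s\ge0$ with $\sum_ic_i^s=1$; $\alpha=\dim_{\mathrm H}F_\emptyset$; $\beta=\overline{\dim}_{\mathrm B}C$; $\gamma\ge0$ is defined by $\limsup_{k\to\infty}|\{T_I:I\in\mathcal I_k\}|^{1/k}=2^\gamma$. $\overline{\dim}_{\mathrm B}$ is upper box dimension. *)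

(* Defs.v *)
From HB Require Import structures.
From mathcomp Require Import all_boot all_order all_algebra.

From mathcomp Require Import all_classical all_reals all_analysis.
From mathcomp Require Import finmap.
Set Implicit Arguments. Unset Strict Implicit. Unset Printing Implicit Defensive.
Import Order.TTheory GRing.Theory Num.Def Num.Theory.
Import numFieldTopology.Exports numFieldNormedType.Exports.
Local Open Scope fset_scope.
Local Open Scope classical_set_scope.
Local Open Scope ring_scope.

Section Defs.
Variables (R : realType) (d : nat).
Notation pt := 'cV[R]_d.

Definition edist (x y : pt) : R := Num.sqrt (\sum_(i < d) (x i ord0 - y i ord0) ^+ 2).

Definition diam_le (U : set pt) (delta : R) : Prop :=
  forall x y, U x -> U y -> edist x y <= delta.

(* Diameter of a set (sup of distances; used for nonempty bounded sets). *)
Definition diam (U : set pt) : R := sup [set edist x y | x in U & y in U].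

Definition diam_pow (U : set pt) (t : R) : R :=
  if `[< U !=set0 >] then diam U `^ t else 0.

Definition hausdorff_delta (t delta : R) (A : set pt) : \bar R :=
  ereal_inf [set (\sum_(0 <= n <oo) (diam_pow (U n) t)%:E)%E
            | U in [set U : nat -> set pt |
                    A `<=` \bigcup_n U n /\ forall n, diam_le (U n) delta]].

Definition hausdorff (t : R) (A : set pt) : \bar R :=
  ereal_sup [set hausdorff_delta t delta A | delta in [set delta : R | 0 < delta]].

Definition hdim (A : set pt) : \bar R :=
  ereal_inf [set t%:E | t in [set t : R | 0 <= t /\ hausdorff t A = 0%E]].

Definition ncover (delta : R) (A : set pt) : \bar R :=
  ereal_inf [set (n%:R)%:E | n in [set n : nat | exists U : nat -> set pt,
       A `<=` \bigcup_(i in `I_n) U i /\ forall i, diam_le (U i) delta]].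

Definition ubdim (A : set pt) : \bar R :=
  limf_esup (fun delta : R => (ln (fine (ncover delta A)) / - ln delta)%:E) (0^'+).

Definition orthogonal_mx (M : 'M[R]_d) : Prop := M^T *m M = 1%:M.

Definition simil (c : R) (M : 'M[R]_d) (b : pt) (x : pt) : pt := c *: (M *m x) + b.

(* Contraction ratio c_I and linear part T_I of S_I = S_{i1} o ... o S_{in}. *)
Definition word_ratio (I : finType) (c : I -> R) (w : seq I) : R := \prod_(i <- w) c i.
Definition word_lin (I : finType) (c : I -> R) (M : I -> 'M[R]_d) (w : seq I) : 'M[R]_d :=
  foldr (fun i A => (c i *: M i) *m A) 1%:M w.

Definition words_k (I : finType) (c : I -> R) (k : nat) : set (seq I) :=
  [set w | w != [::] /\ (2 ^- k.+1 < word_ratio c w) /\ (word_ratio c w <= 2 ^- k)].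

Definition count_lin (I : finType) (c : I -> R) (M : I -> 'M[R]_d) (k : nat) : nat :=
  #|` fset_set (word_lin c M @` words_k c k) |%fset.

End Defs.

Definition bound_fun (R : realType) (d : nat) (s alpha beta gamma x : R) : R :=
  Num.min (Num.min (x * s + (1 - x) * beta) (x * alpha + (1 - x) * d%:R))
          (Num.min (alpha + (1 - x) * (beta + d%:R - 1)) (alpha + x * gamma + (1 - x) * beta)).

(* Main.v *)
(* At scale 2^-n, the attractor is covered by pieces S_w(C) with c_w of order
   2^-k, k <= n, and by copies of F_C of diameter of order 2^-n that stay close
   to the homogeneous attractor F_0.  With k = x n, the pieces at level k are
   covered in four ways: word by word; as part of the 2^-k-neighbourhood of F_0;
   as translates, based at F_0, of the images of C under all rotations, that is
   of families of spherical shells; and as such translates of the images of C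
   under the linear parts T_w.  The covering numbers of F_0 are governed by its
   Hausdorff dimension: were they larger, well separated small copies of F_0
   inside F_0 would form a subsystem forcing sum |U_j|^t to be bounded below for
   every cover (U_j) of F_0. *)
Require Import Defs.
From HB Require Import structures.
From mathcomp Require Import all_boot all_order all_algebra.

From mathcomp Require Import all_classical all_reals all_analysis.
From mathcomp Require Import finmap ring lra zify.
Import Order.TTheory GRing.Theory Num.Def Num.Theory.
Import numFieldTopology.Exports numFieldNormedType.Exports.
(* MathComp-Analysis has an unrelated [edist], which this import shadows. *)
Import Defs.
Set Implicit Arguments. Unset Strict Implicit. Unset Printing Implicit Defensive.
Local Open Scope fset_scope.
Local Open Scope classical_set_scope.
Local Open Scope ring_scope.

(** No separation of the maps is assumed, so copies indexed by different words may overlap: counting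
    words gives the exponent s, whereas counting base points in F_0 gives alpha. With n = k + j and
    x = k/n, a piece of ratio about 2^-k only needs C at scale 2^-j. The cover by rotations costs
    2^(j beta) shells and 2^(j(d-1)) cells on each. The obstacle there is that the radius of a shell
    also depends on c_w; but c_w depends only on the letter counts of w, and words of level k have
    O(k) letters, so only polynomially many ratios occur. Polynomial factors, among them the number
    n + 1 of levels, are absorbed by an arbitrarily small loss e in the exponent. The best of the
    four covers is chosen separately for each k, which is why the minimum stands inside the maximum
    over x. *)

(** * Euclidean distance on column vectors, and its comparison with the sup norm *)

Section EuclideanDistance.
Variables (R : realType) (d : nat).
Implicit Types (x y z v : 'cV[R]_d) (M : 'M[R]_d).

Lemma edist_ge0 x y : 0 <= edist x y.
Proof. exact: sqrtr_ge0. Qed.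

Lemma edistxx x : edist x x = 0.
Proof. by rewrite /edist big1 ?sqrtr0// => i _; rewrite subrr expr0n. Qed.

Lemma edistC x y : edist x y = edist y x.
Proof.
by rewrite /edist; congr Num.sqrt; apply: eq_bigr => i _; rewrite -sqrrN opprB.
Qed.

Lemma edist_sub0 x y : edist x y = edist (x - y) 0.
Proof.
by rewrite /edist; congr Num.sqrt; apply: eq_bigr => i _; rewrite !mxE subr0.
Qed.

Lemma edist_sqr x y : edist x y ^+ 2 = \sum_(i < d) (x i ord0 - y i ord0) ^+ 2.
Proof. by rewrite sqr_sqrtr// sumr_ge0// => i _; exact: sqr_ge0. Qed.

(** Expanding the sum of the squares (A g_i - B f_i)^2 gives A (A G - B^2), which is nonnegative;
    cancelling A requires the case A = 0 to be treated apart. *)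
Lemma cauchy_schwarz_sum (f g : 'I_d -> R) :
  (\sum_i f i * g i) ^+ 2 <= (\sum_i f i ^+ 2) * (\sum_i g i ^+ 2).
Proof.
set A := \sum_i f i ^+ 2; set B := \sum_i f i * g i; set G := \sum_i g i ^+ 2.
have A0 : 0 <= A by apply: sumr_ge0 => i _; exact: sqr_ge0.
have [A00|An0] := eqVneq A 0.
  have f0 i : f i = 0.
    have /(_ i erefl)/eqP := @psumr_eq0P _ _ predT (fun i => f i ^+ 2)
      (fun i _ => sqr_ge0 (f i)) A00.
    by rewrite sqrf_eq0 => /eqP.
  by rewrite A00 mul0r /B big1 ?expr0n// => i _; rewrite f0 mul0r.
have {An0}A0 : 0 < A by rewrite lt_neqAle eq_sym An0.
have : 0 <= \sum_i (A * g i - B * f i) ^+ 2.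
  by apply: sumr_ge0 => i _; exact: sqr_ge0.
have -> : \sum_i (A * g i - B * f i) ^+ 2 = A * (A * G - B ^+ 2).
  transitivity (A ^+ 2 * (\sum_i g i ^+ 2) - A * (B *+ 2) * (\sum_i f i * g i)
    + B ^+ 2 * (\sum_i f i ^+ 2)); last by rewrite -/A -/B -/G; ring.
  clearbody A B G; rewrite !mulr_sumr -sumrB -big_split /=.
  apply: eq_bigr => i _; ring.
by rewrite pmulr_rge0// subr_ge0.
Qed.

Lemma edist_triangle y x z : edist x z <= edist x y + edist y z.
Proof.
rewrite -(@ler_pXn2r _ 2)// ?nnegrE ?addr_ge0 ?edist_ge0//.
rewrite sqrrD !edist_sqr.
have -> : \sum_(i < d) (x i ord0 - z i ord0) ^+ 2 =
    \sum_(i < d) (x i ord0 - y i ord0) ^+ 2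
    + (\sum_(i < d) (x i ord0 - y i ord0) * (y i ord0 - z i ord0)) *+ 2
    + \sum_(i < d) (y i ord0 - z i ord0) ^+ 2.
  by rewrite -sumrMnl -!big_split /=; apply: eq_bigr => i _; ring.
rewrite lerD2r lerD2l lerMn2r /=.
apply: le_trans (ler_norm _) _.
rewrite -(@ler_pXn2r _ 2)// ?nnegrE ?mulr_ge0 ?edist_ge0//.
rewrite exprMn !edist_sqr real_normK ?num_real//.
exact: cauchy_schwarz_sum.
Qed.

Lemma edistDl v x y : edist (v + x) (v + y) = edist x y.
Proof. by rewrite edist_sub0 opprD addrACA subrr add0r -edist_sub0. Qed.

Lemma edistDr v x y : edist (x + v) (y + v) = edist x y.
Proof. by rewrite !(addrC _ v) edistDl. Qed.

Lemma edistD x y z v : edist (x + y) (z + v) <= edist x z + edist y v.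
Proof.
apply: le_trans (edist_triangle (z + y) _ _) _.
by rewrite edistDl edistDr.
Qed.

Lemma edistZ (a : R) x y : 0 <= a -> edist (a *: x) (a *: y) = a * edist x y.
Proof.
move=> a0; apply/eqP; rewrite -(@eqrXn2 _ 2)// ?mulr_ge0 ?edist_ge0//.
rewrite exprMn !edist_sqr mulr_sumr; apply/eqP/eq_bigr => i _.
by rewrite !mxE -mulrBr exprMn.
Qed.

Lemma edist0_sqr x : edist x 0 ^+ 2 = (x^T *m x) ord0 ord0.
Proof.
by rewrite edist_sqr !mxE; apply: eq_bigr => i _; rewrite !mxE subr0 expr2.
Qed.

Lemma edist_orth M x y : orthogonal_mx M -> edist (M *m x) (M *m y) = edist x y.
Proof.
move=> oM; rewrite edist_sub0 -mulmxBr [RHS]edist_sub0.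
apply/eqP; rewrite -(@eqrXn2 _ 2)// ?edist_ge0// !edist0_sqr.
by rewrite trmx_mul -mulmxA (mulmxA M^T) oM mul1mx.
Qed.

Lemma coord_le_edist x y i : `|x i ord0 - y i ord0| <= edist x y.
Proof.
rewrite -(@ler_pXn2r _ 2)// ?nnegrE ?edist_ge0// real_normK ?num_real//.
rewrite edist_sqr (bigD1 i)//= lerDl.
by apply: sumr_ge0 => j _; exact: sqr_ge0.
Qed.

(** The factor [d] in place of its square root is coarse but harmless: dimensions ignore constant
    factors. *)
Lemma edist_le_coord x y (r : R) : 0 <= r ->
  (forall i, `|x i ord0 - y i ord0| <= r) -> edist x y <= d%:R * r.
Proof.
move=> r0 xyr; rewrite -(@ler_pXn2r _ 2)// ?nnegrE ?edist_ge0 ?mulr_ge0//.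
rewrite edist_sqr (@le_trans _ _ (\sum_(i < d) r ^+ 2))//.
  apply: ler_sum => i _; rewrite -[leLHS]real_normK ?num_real//.
  by rewrite ler_pXn2r// nnegrE.
rewrite sumr_const card_ord -[leLHS]mulr_natl exprMn ler_wpM2r ?sqr_ge0//.
by rewrite -natrX ler_nat; case: (d) => // n; rewrite expnS leq_pmulr// expn1.
Qed.

Lemma edist_le_norm x y : edist x y <= d%:R * `|x - y|.
Proof.
apply: edist_le_coord => // i.
suff -> : x i ord0 - y i ord0 = (x - y) i ord0.
  rewrite [leRHS]/normr /= mx_normrE; apply/bigmax_geP; right => /=.
  by exists (i, ord0).
by rewrite !mxE.
Qed.

Lemma open_edist_ball x (r : R) : open [set y | edist x y < r].
Proof.
rewrite openE => y /= xyr; rewrite /interior.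
(* Neighbourhoods are those of the sup norm, at the cost of a factor [d]; dividing by [d.+1] keeps
   the inequality strict and makes sense for d = 0. *)
pose e := (r - edist x y) / d.+1%:R.
have e0 : 0 < e by rewrite divr_gt0// subr_gt0.
apply/nbhs_ballP; exists e => //= z [_ yz] /=.
apply: le_lt_trans (edist_triangle y _ _) _.
rewrite -ltrBrDl; apply: (@le_lt_trans _ _ (d%:R * e)).
  by apply: edist_le_coord => [|i]; rewrite ltW//; exact: (yz i ord0).
by rewrite /e mulrCA gtr_pMr ?subr_gt0// ltr_pdivrMr// mul1r ltr_nat.
Qed.

Lemma compact_edist_bounded (A : set 'cV[R]_d) x : compact A ->
  exists2 D : R, 0 < D & forall y, A y -> edist x y <= D.
Proof.
move=> /compact_bounded[r [_ /(_ (`|r| + 1))]] Ar.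
have {}Ar : forall y, A y -> `|y| <= `|r| + 1.
  by apply: Ar; rewrite (le_lt_trans (ler_norm r))// ltrDl.
exists (edist x 0 + d%:R * (`|r| + 1) + 1).
  by rewrite ltr_wpDl// addr_ge0 ?edist_ge0// mulr_ge0// addr_ge0.
move=> y Ay; apply: le_trans (edist_triangle 0 _ _) _.
rewrite -addrA lerD2l edistC (le_trans (edist_le_norm _ _))// subr0.
by rewrite ler_wpDr// ler_wpM2l// Ar.
Qed.

End EuclideanDistance.

(** * Covers expressed by finite labellings, and grids *)

Section Codings.
Variables (R : realType) (d : nat).
Implicit Types (A : set 'cV[R]_d) (delta N : R).

(** [E] need not be an equivalence: below it is sometimes an implication whose premise is supplied
    by another labelling. [N] is real so that it can be a bound with real exponents. *)
Definition labelled (Z : Type) (P : set Z) (E : Z -> Z -> Prop) N :=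
  exists (T : eqType) (s : seq T) (f : Z -> T),
    [/\ (size s)%:R <= N, forall z, P z -> f z \in s &
        forall z z', P z -> P z' -> f z = f z' -> E z z'].

(* This amounts to a cover of [g @` P] by [N] sets of diameter at most [delta];
   the advantage of labels over covers is that they combine by pairing. *)
Definition coded (Z : Type) (P : set Z) (g : Z -> 'cV[R]_d) delta N :=
  labelled P (fun z z' => edist (g z) (g z') <= delta) N.

Lemma labelled_weaken Z (P : set Z) E E' N N' :
  (forall z z', P z -> P z' -> E z z' -> E' z z') -> N <= N' ->
  labelled P E N -> labelled P E' N'.
Proof.
move=> EE NN [T [s [f [sN fs fd]]]]; exists T, s, f; split => //.
  exact: le_trans NN.
by move=> z z' Pz Pz' /fd-/(_ Pz Pz'); exact: EE.
Qed.

Lemma labelled_and Z (P : set Z) E E' N N' :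
  labelled P E N -> labelled P E' N' ->
  labelled P (fun z z' => E z z' /\ E' z z') (N * N').
Proof.
move=> [T [s [f [sN fs fd]]]] [T' [s' [f' [sN' fs' fd']]]].
exists (T * T')%type, [seq (x, y) | x <- s, y <- s'], (fun z => (f z, f' z)).
split.
- by rewrite size_allpairs natrM ler_pM.
- by move=> z Pz; apply: (allpairs_f pair); [exact: fs|exact: fs'].
- by move=> z z' Pz Pz' [/fd-/(_ Pz Pz') ? /fd'-/(_ Pz Pz')].
Qed.

Lemma labelled_seq Z (P : set Z) (T : eqType) (s : seq T) (f : Z -> T) :
  (forall z, P z -> f z \in s) ->
  labelled P (fun z z' => f z = f z') (size s)%:R.
Proof. by move=> fs; exists T, s, f. Qed.

Lemma labelled_fin Z (P : set Z) (T : finType) (f : Z -> T) :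
  labelled P (fun z z' => f z = f z') #|T|%:R.
Proof.
by rewrite cardE; apply: labelled_seq => z _; rewrite mem_enum.
Qed.

Lemma coded_comp Z (P : set Z) (h : Z -> 'cV[R]_d) A delta N :
  (forall z, P z -> A (h z)) -> coded A id delta N -> coded P h delta N.
Proof.
move=> PA [T [s [f [sN fs fd]]]]; exists T, s, (f \o h); split => //=.
  by move=> z /PA/fs.
by move=> z z' /PA Pz /PA Pz'; exact: fd.
Qed.

Lemma coded_le Z (P : set Z) g delta delta' N N' : delta <= delta' -> N <= N' ->
  coded P g delta N -> coded P g delta' N'.
Proof.
move=> dd NN [T [s [f [sN fs fd]]]]; exists T, s, f; split => //.
  exact: le_trans NN.
by move=> z z' Pz Pz' /fd-/(_ Pz Pz')/le_trans; apply.
Qed.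

Lemma coded_sub Z (P Q : set Z) g delta N : Q `<=` P ->
  coded P g delta N -> coded Q g delta N.
Proof.
move=> QP [T [s [f [sN fs fd]]]]; exists T, s, f; split => // [z /QP/fs//|].
by move=> z z' /QP Pz /QP Pz'; exact: fd.
Qed.

Lemma coded_image Z (P : set Z) g delta N A : A `<=` g @` P ->
  coded P g delta N -> coded A id delta N.
Proof.
move=> AP [T [s [f [sN fs fd]]]].
(* The label of a chosen preimage under [g]; [None] marks points outside the image and never occurs
   on [A]. *)
pose h x := if pselect (exists2 z, P z & g z = x) is left e
  then Some (f (s2val (cid2 e))) else None.
exists (option T), (map Some s), h; split; first by rewrite size_map.
  move=> x /AP Px; rewrite /h; case: pselect => // e.
  by case: (cid2 e) => z Pz _ /=; rewrite map_f// fs.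
move=> x y /AP Px /AP Py; rewrite /h; case: pselect => // ex.
case: pselect => // ey; case: (cid2 ex) => z Pz gz; case: (cid2 ey) => z' Pz' gz'.
by move=> /= [/fd]; rewrite -gz -gz'; apply.
Qed.

Lemma coded_setU A B delta N N' : coded A id delta N -> coded B id delta N' ->
  coded (A `|` B) id delta (N + N').
Proof.
move=> [T [s [f [sN fs fd]]]] [T' [s' [f' [sN' fs' fd']]]].
exists (T + T')%type, (map inl s ++ map inr s'),
  (fun z => if `[< A z >] then inl (f z) else inr (f' z)); split.
- by rewrite size_cat !size_map natrD lerD.
- move=> z ABz; rewrite mem_cat; case: asboolP => Az.
    by rewrite (map_f inl)// fs.
  by rewrite (map_f inr) ?orbT// fs'//; case: ABz.
- move=> z z' ABz ABz'; case: asboolP => Az; case: asboolP => Az' // [].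
    exact: fd.
  by apply: fd'; [case: ABz|case: ABz'].
Qed.

Lemma coded_bigcup (F : nat -> set 'cV[R]_d) delta N n :
  (forall k, (k <= n)%N -> coded (F k) id delta N) ->
  coded (\bigcup_(k in `I_n.+1) F k) id delta (n.+1%:R * N).
Proof.
elim: n => [|n IH] FN.
  rewrite mul1r; apply: coded_sub (FN 0 (leqnn _)) => x [k /=].
  by rewrite ltnS leqn0 => /eqP ->.
have := coded_setU (IH (fun k kn => FN k (leqW kn))) (FN n.+1 (leqnn _)).
rewrite -[X in _ + X]mul1r -mulrDl natr1; apply: coded_sub => x [k /=].
rewrite ltnS leq_eqVlt => /predU1P[->|kn Fx]; first by right.
by left; exists k.
Qed.

Lemma ncover_le_coded A delta N : 0 <= delta -> coded A id delta N ->
  (ncover delta A <= N%:E)%E.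
Proof.
move=> d0 [T [s [f [sN fs fd]]]]; apply: ge_ereal_inf.
exists (size s)%:R%:E; last by rewrite lee_fin.
exists (size s) => //.
exists (fun i => [set x | A x /\ index (f x) s = i]); split.
  by move=> x Ax; exists (index (f x) s) => //=; rewrite index_mem fs.
move=> i x y [Ax <-] [Ay] /esym fxy; apply: fd => //.
by rewrite -(nth_index (f x) (fs x Ax)) fxy nth_index ?fs.
Qed.

Lemma coded_of_ncover A delta N : (ncover delta A < N%:E)%E ->
  coded A id delta N.
Proof.
move=> /ereal_inf_lt[_ [n [U [AU Ud]] <-]]; rewrite lte_fin => nN.
have /choice[f fP] : forall x, exists i, A x -> (i < n)%N /\ U i x.
  move=> x; case: (pselect (A x)) => [/AU[i /= ni Ui]|nA]; first by exists i.
  by exists 0.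
exists nat, (iota 0 n), f; split; first by rewrite size_iota ltW.
  by move=> x /fP[fn _]; rewrite mem_iota.
by move=> x y /fP[_ Ux] /fP[_ Uy] fxy; apply: (Ud (f x)) => //; rewrite fxy.
Qed.

(* Reducing the index of a grid cell modulo [m.+1] still separates points that
   are less than [m] cells apart. *)
Definition grid_index delta (m : nat) (x : R) : 'I_m.+1 :=
  inord `|(Num.floor (x / delta)%R %% m.+1%:Z)%Z|%N.

Lemma grid_index_inj delta m x y : 0 < delta -> `|x - y| < m%:R * delta ->
  grid_index delta m x = grid_index delta m y -> `|x - y| <= delta.
Proof.
move=> d0 xym /(congr1 val).
have m0 : (m.+1%:Z != 0) by [].
have lt_mod (a : int) : (`|(a %% m.+1%:Z)%Z| < m.+1)%N.
  by rewrite -ltz_nat gez0_abs ?modz_ge0// ltz_pmod.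
rewrite /grid_index /= !inordK//.
set a := Num.floor (x / delta); set b := Num.floor (y / delta) => eqab.
have /andP[ax xa] := floor_itv (x / delta).
have /andP[by_ yb] := floor_itv (y / delta).
have xyd : x - y = (x / delta - y / delta) * delta.
  by rewrite mulrBl !divfK ?gt_eqF.
move: xym; rewrite xyd normrM (gtr0_norm d0) ltr_pM2r// => xym.
rewrite -[leRHS]mul1r ler_pM2r//.
suff abE : a = b.
  move: ax xa by_ yb; rewrite -/a -/b abE !intrD ler_norml.
  by move=> *; apply/andP; split; lra.
have /eqP : (a %% m.+1%:Z)%Z = (b %% m.+1%:Z)%Z.
  by rewrite -(gez0_abs (modz_ge0 a m0)) eqab gez0_abs ?modz_ge0.
rewrite eqz_mod_dvd => /dvdzP[q abq].
(* As |x - y| < m delta, the two floors differ by less than m + 1, so being congruent modulo m + 1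
   they coincide. *)
have : `|(a - b)%:~R : R| < m.+1%:R.
  move: xym ax xa by_ yb; rewrite -/a -/b !intrD mulrSr !ltr_norml.
  by rewrite !mulrNz /= => /andP[? ?] *; apply/andP; split; lra.
rewrite abq -intr_norm -[m.+1%:R]/(m.+1%:Z%:~R) ltr_int normrM.
rewrite -[ltRHS]mul1r ltr_pM2r//; case: q abq => [[|q]|q] //=.
by rewrite mul0r => /eqP; rewrite subr_eq0 => /eqP.
Qed.

(** Makes the covering numbers of bounded sets finite, so that [fine] in [ubdim] does not replace an
    infinite value. *)
Lemma bounded_coded A delta : 0 < delta ->
  (exists D, forall x y, A x -> A y -> edist x y <= D) ->
  exists N, coded A id delta N.
Proof.
move=> d0 [D AD].
pose e := delta / d.+1%:R; have e0 : 0 < e by rewrite divr_gt0.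
pose m := (Num.truncn (D / e)).+1.
exists (#|{: {ffun 'I_d -> 'I_m.+1}}|%:R).
exists {ffun 'I_d -> 'I_m.+1}, (enum {: {ffun 'I_d -> 'I_m.+1}}),
  (fun x => [ffun i => grid_index e m (x i ord0)]); split.
- by rewrite -cardE.
- by move=> x _; rewrite mem_enum.
- move=> x y Ax Ay /ffunP exy; apply: (@le_trans _ _ (d%:R * e)).
    apply: edist_le_coord => [|i]; first exact: ltW.
    apply: (@grid_index_inj _ m) => //; last by have := exy i; rewrite !ffunE.
    apply: le_lt_trans (coord_le_edist _ _ _) _.
    apply: le_lt_trans (AD _ _ Ax Ay) _.
    by rewrite -ltr_pdivrMr// truncnS_gt.
  by rewrite /e mulrCA ger_pMr// ler_pdivrMr// mul1r ler_nat.
Qed.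

End Codings.

(** * Exponential growth rates, and upper box dimension at dyadic scales *)

Section Growth.
Variable R : realType.
Implicit Types (x y e : R) (n : nat).

Lemma pow2_gt0 x : 0 < 2 `^ x :> R.
Proof. exact: powR_gt0. Qed.

Lemma pow2D x y : 2 `^ (x + y) = 2 `^ x * 2 `^ y :> R.
Proof. by rewrite powRD// pnatr_eq0 implybT. Qed.

Lemma pow2_le x y : x <= y -> 2 `^ x <= 2 `^ y :> R.
Proof. by move=> xy; rewrite ler_powR// ler1n. Qed.

Lemma pow2_lt x y : x < y -> 2 `^ x < 2 `^ y :> R.
Proof.
by move=> xy; rewrite /powR pnatr_eq0 /= ltr_expR ltr_pM2r// ln_gt0// ltr1n.
Qed.

Lemma pow2n n : 2 `^ n%:R = 2 ^+ n :> R.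
Proof. by rewrite powR_mulrn. Qed.

Lemma pow2Vn n : 2 `^ (- n%:R) = 2 ^- n :> R.
Proof. by rewrite powRN pow2n. Qed.

Lemma pow2_ln x : 0 < x -> 2 `^ (ln x / ln 2) = x.
Proof.
move=> x0; rewrite /powR pnatr_eq0 /= divfK ?lnK//.
by rewrite gt_eqF// ln_gt0// ltr1n.
Qed.

Lemma ln_pow2 x : ln (2 `^ x) = x * ln 2 :> R.
Proof. exact: ln_powR. Qed.

(** For x <= 0, where [ln] takes a default value, the conclusion follows from the sign of y
    alone. *)
Lemma le_of_ln_le x y : 0 < y -> ln x <= ln y -> x <= y.
Proof.
move=> y0 xy; have [x0|x0] := ltP 0 x; first by rewrite -ler_ln.
exact: le_trans (ltW y0).
Qed.

Lemma poly_le_pow2 (p : nat) e : 0 < e ->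
  exists2 K : R, 1 <= K & forall n, n.+1%:R ^+ p <= K * 2 `^ (n%:R * e).
Proof.
move=> e0; case: p => [|p].
  exists 1 => // n; rewrite expr0 mul1r -[leLHS](powRr0 2).
  by rewrite pow2_le// mulr_ge0// ltW.
have l2 : 0 < ln 2 :> R by rewrite ln_gt0// ltr1n.
pose a := e / p.+1%:R * ln 2; have a0 : 0 < a by rewrite mulr_gt0 ?divr_gt0.
(* As b <= 1 and b <= a, one has b (n + 1) <= 1 + n a <= exp(n a); raising this to the power [p.+1]
   dictates the constant. *)
pose b := Num.min 1 a; have b0 : 0 < b by rewrite lt_min ltr01.
exists (b^-1 ^+ p.+1) => [|n].
  by rewrite exprn_ege1// invf_ge1// ge_min lexx.
have -> : 2 `^ (n%:R * e) = (2 `^ (n%:R * (e / p.+1%:R))) ^+ p.+1.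
  by rewrite -powR_mulrn ?powR_ge0// -powRrM -mulrA divfK.
rewrite -exprMn lerXn2r ?nnegrE ?mulr_ge0 ?invr_ge0 ?(ltW b0) ?powR_ge0//.
rewrite ler_pdivlMl// /powR pnatr_eq0 /= -mulrA -/a.
apply: le_trans (expR_ge1Dx _); rewrite -natr1 mulrDr mulr1 addrC.
by rewrite lerD ?ge_min ?lexx// mulrC ler_wpM2l// ge_min lexx orbT.
Qed.

Lemma limn_esup_root_le (u : nat -> R) (g g' : R) : (forall n, 0 <= u n) ->
  limn_esup (fun n => (u n `^ n%:R^-1)%:E) = (2 `^ g)%:E -> 0 <= g' -> g < g' ->
  exists2 K : R, 1 <= K & forall n, u n <= K * 2 `^ (n%:R * g').
Proof.
move=> u0 ug g'0 gg'.
have : (limn_esup (fun n => (u n `^ n%:R^-1)%:E) < (2 `^ g')%:E)%E.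
  by rewrite ug lte_fin pow2_lt.
move=> /ereal_inf_lt[_ [V [k0 _ k0V] <-] Vlt].
have u1 n : (k0 < n)%N -> u n <= 2 `^ (n%:R * g').
  move=> k0n; have n0 : n%:R != 0 :> R by rewrite pnatr_eq0 -lt0n (leq_trans _ k0n).
  have -> : u n = (u n `^ n%:R^-1) ^+ n.
    by rewrite -powR_mulrn ?powR_ge0// -powRrM mulVf// powRr1.
  rewrite (mulrC _ g') powRrM powR_mulrn ?powR_ge0//.
  rewrite lerXn2r ?nnegrE ?powR_ge0// -lee_fin; apply: ltW; apply: le_lt_trans Vlt.
  by apply: ereal_sup_ubound; exists n => //; apply: k0V => /=; exact: ltnW.
(* The indices up to [k0] are absorbed by the constant, among them n = 0, where the exponent
   [n%:R^-1] is 0 by convention. *)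
exists (1 + \sum_(k < k0.+1) u k) => [|n]; first by rewrite lerDl sumr_ge0.
have [nk0|k0n] := leqP n k0.
  rewrite (@le_trans _ _ (1 + \sum_(k < k0.+1) u k))//.
    rewrite (bigD1 (Ordinal (nk0 : (n < k0.+1)%N)))//= addrCA lerDl.
    by rewrite addr_ge0// sumr_ge0.
  rewrite ler_peMr ?addr_ge0 ?sumr_ge0// -[leLHS](powRr0 2).
  by rewrite pow2_le// mulr_ge0.
apply: le_trans (u1 _ k0n) _.
by rewrite ler_peMl ?powR_ge0// lerDl sumr_ge0.
Qed.

Variable d : nat.
Implicit Type A : set 'cV[R]_d.

Lemma ubdim_coded A (a a' : R) : compact A -> ubdim A = a%:E -> a < a' ->
  exists2 K : R, 1 <= K &
    forall n, coded A id (2 ^- n) (K * 2 `^ (n%:R * a')).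
Proof.
move=> cA Aa aa'.
have : (ubdim A < a'%:E)%E by rewrite Aa lte_fin.
move=> /ereal_inf_lt[_ [V V0 <-] Vlt].
have [e /= e0 eV] : exists2 e : R, 0 < e & forall x, 0 < x -> x < e -> V x.
  move: V0 => /= /nbhs_ballP[e /= e0 eV]; exists e => // x x0 xe.
  by apply: eV => //; rewrite -ball_normE /= sub0r normrN gtr0_norm.
pose n0 := (Num.truncn (Num.max 1 e^-1)).+1.
have small n : (n0 <= n)%N -> 2 ^- n < Num.min 1 e.
  move=> n0n; rewrite lt_min; have en : Num.max 1 e^-1 < 2 ^+ n.
    apply: (@lt_le_trans _ _ n0%:R); first exact: truncnS_gt.
    rewrite (@le_trans _ _ n%:R) ?ler_nat// -natrX ler_nat ltnW//.
    exact: ltn_expl.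
  move: en; rewrite gt_max => /andP[n1 ne]; apply/andP; split.
    by rewrite invf_lt1// exprn_gt0.
  by rewrite -[e]invrK ltf_pV2// posrE ?invr_gt0 ?exprn_gt0.
(* The factor 2 provides the strict inequality that [coded_of_ncover] requires. *)
have big n : (n0 <= n)%N -> coded A id (2 ^- n) (2 * 2 `^ (n%:R * a')).
  move=> n0n; have := small _ n0n; rewrite lt_min => /andP[n1 ne].
  have d0 : 0 < 2 ^- n :> R by rewrite invr_gt0 exprn_gt0.
  apply: coded_of_ncover.
  have [N AN] : exists N, coded A id (2 ^- n) N.
    apply: bounded_coded => //; have [D _ AD] := compact_edist_bounded 0 cA.
    exists (D + D) => x y Ax Ay; apply: le_trans (edist_triangle 0 _ _) _.
    by rewrite (edistC x) lerD// AD.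
  have nc0 : (0 <= ncover (2 ^- n) A)%E.
    by apply: le_ereal_inf_tmp => _ [k _ <-]; rewrite lee_fin.
  have := ncover_le_coded (ltW d0) AN.
  case E : (ncover (2 ^- n) A) nc0 => [c| |] // c0 _.
  have : ((ln c / - ln (2 ^- n))%:E < a'%:E)%E.
    apply: le_lt_trans Vlt; apply: ereal_sup_ubound.
    by exists (2 ^- n); [exact: eV|rewrite E].
  rewrite lte_fin -pow2Vn ln_pow2 => lnc.
  have n_gt0 : (0 < n)%N by rewrite (leq_trans _ n0n).
  have l2 : 0 < ln 2 :> R by rewrite ln_gt0// ltr1n.
  rewrite lte_fin (@le_lt_trans _ _ (2 `^ (n%:R * a')))//.
    apply: le_of_ln_le; rewrite ?pow2_gt0// ln_pow2.
    move: lnc; rewrite mulNr opprK ltr_pdivrMr ?mulr_gt0 ?ltr0n// => /ltW.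
    by rewrite mulrA (mulrC a').
  by rewrite ltr_pMl ?pow2_gt0// ltr1n.
(* For n < n0 the cover at the finer scale 2^-n0 is reused; the exponent n0 |a'| dominates (n0 - n)
   a' whatever the sign of a'. *)
pose K := 2 * 2 `^ (n0%:R * `|a'|) : R.
have K2 : 2 <= K by rewrite ler_peMr// -[leLHS](powRr0 2) pow2_le// mulr_ge0.
exists K => [|n]; first by rewrite (le_trans _ K2)// ler1n.
have [n0n|nn0] := leqP n0 n.
  by apply: coded_le (big _ n0n) => //; rewrite ler_wpM2r// powR_ge0.
apply: coded_le (big n0 (leqnn _)).
  by rewrite lef_pV2 ?posrE ?exprn_gt0// ler_eXn2l ?ltr1n// ltnW.
rewrite -mulrA ler_pM2l// -pow2D pow2_le//.
rewrite -lerBlDr -mulrBl; apply: le_trans (ler_norm _) _.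
rewrite normrM ler_wpM2r// ger0_norm ?subr_ge0 ?ler_nat 1?ltnW//.
by rewrite gerBl.
Qed.

(** A real scale x is compared with a dyadic scale 2^-n between x/(2K) and x/K; the constants are
    negligible against -ln x as x tends to 0. *)
Lemma coded_ubdim A (r : R) : 0 <= r ->
  (forall e, 0 < e -> exists2 K : R, 1 <= K &
    forall n, coded A id (K * 2 ^- n) (K * 2 `^ (n%:R * (r + e)))) ->
  (ubdim A <= r%:E)%E.
Proof.
move=> r0 Ar; apply/lee_addgt0Pr => _/posnumP[e].
have e20 : 0 < e%:num / 2 by [].
have [K K1 AK] := Ar _ e20.
set t := r + e%:num / 2 in AK.
have t0 : 0 < t by rewrite ltr_wpDl.
have K0 : 0 < K by rewrite (lt_le_trans _ K1).
(* The constant part of ln (K 2^(n t)) once 2^n <= 2K/x; the set [V] below consists of x so small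
   that a <= (e/2)(-ln x). *)
pose a := ln K + t * ln (2 * K).
apply: ge_ereal_inf.
pose V := [set x : R | 0 < x < Num.min 1 (expR (- (a / (e%:num / 2))))].
exists (ereal_sup [set (ln (fine (ncover x A)) / - ln x)%:E | x in V]).
  exists V => //; near=> x => /=; rewrite /V /=.
  apply/andP; split; first by near: x; exact: nbhs_right_gt.
  by near: x; apply: nbhs_right_lt; rewrite lt_min ltr01 expR_gt0.
apply: ge_ereal_sup => _ [x /= /andP[x0 xlt] <-].
move: xlt; rewrite lt_min => /andP[x1 xe].
have lx : 0 < - ln x by rewrite oppr_gt0 ln_lt0// x0.
rewrite -EFinD lee_fin ler_pdivrMr//.
pose n := (Num.truncn (ln (K / x) / ln 2)).+1.
have l2 : 0 < ln 2 :> R by rewrite ln_gt0// ltr1n.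
have Kx1 : 1 <= K / x by rewrite ler_pdivlMr// mul1r (le_trans (ltW x1)).
have L0 : 0 <= ln (K / x) / ln 2 by rewrite divr_ge0 ?ln_ge0// ler1n.
have Ln : ln (K / x) / ln 2 < n%:R by exact: truncnS_gt.
have nL : n%:R <= ln (K / x) / ln 2 + 1.
  by rewrite /n -[leLHS]natr1 lerD2r; have /andP[] := truncn_itv L0.
have Ax : coded A id x (K * 2 `^ (n%:R * t)).
  apply: coded_le (AK n) => //.
  rewrite ler_pdivrMr ?exprn_gt0// -ler_pdivrMl// mulrC -pow2n.
  by rewrite -[leLHS]pow2_ln ?divr_gt0// pow2_le// ltW.
have nc0 : (0 <= ncover x A)%E.
  by apply: le_ereal_inf_tmp => _ [k _ <-]; rewrite lee_fin.
have := ncover_le_coded (ltW x0) Ax.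
case: (ncover x A) nc0 => [c| |] //; rewrite !lee_fin /= => c0 cN.
move: c0; rewrite le_eqVlt => /predU1P[<-|c0].
  by rewrite ln0// mulr_ge0 ?addr_ge0 ?(ltW lx).
rewrite (@le_trans _ _ (ln (K * 2 `^ (n%:R * t))))//.
  by rewrite ler_ln ?posrE// mulr_gt0 ?pow2_gt0.
rewrite lnM ?posrE ?pow2_gt0// ln_pow2.
have : a <= e%:num / 2 * - ln x.
  rewrite -ler_pdivrMl// mulrC lerNr -ler_expR lnK ?posrE//.
  exact: ltW.
have : n%:R * ln 2 <= ln (K / x) + ln 2.
  by rewrite -ler_pdivlMr// mulrDl divff ?gt_eqF.
rewrite /a lnM ?posrE ?invr_gt0// lnV ?posrE// lnM ?posrE// => h1 h2.
have h3 : t * (n%:R * ln 2) <= t * (ln K - ln x + ln 2) by rewrite ler_pM2l.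
have h4 : (r + e%:num) * - ln x = t * - ln x + e%:num / 2 * - ln x.
  by rewrite /t -mulrDl; congr (_ * _); field.
rewrite h4; clearbody t; lra.
Unshelve. all: by end_near. Qed.

End Growth.

(** * Words over the alphabet: ratios, counting, and stopping *)

Section Words.
Variables (R : realType) (d : nat) (I : finType).
Variables (c : I -> R) (M : I -> 'M[R]_d) (b : I -> 'cV[R]_d).
Hypothesis c01 : forall i, 0 < c i < 1.
Hypothesis oM : forall i, orthogonal_mx (M i).
Local Notation pt := 'cV[R]_d.
Implicit Types (w : seq I) (x y : pt) (A C F : set pt).

Definition word_map w x : pt := foldr (fun i => simil (c i) (M i) (b i)) x w.

Lemma word_map_cat w w' x : word_map (w ++ w') x = word_map w (word_map w' x).
Proof. by rewrite /word_map foldr_cat. Qed.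

Lemma word_map_sub w x y :
  word_map w x - word_map w y = word_lin c M w *m (x - y).
Proof.
elim: w => [|i w IH] /=; first by rewrite mul1mx.
rewrite /simil opprD addrACA subrr addr0 -scalerBr -mulmxBr IH.
by rewrite -scalemxAl -scalemxAl mulmxA.
Qed.

Lemma word_ratio_gt0 w : 0 < word_ratio c w.
Proof. by apply: prodr_gt0 => i _; case/andP: (c01 i). Qed.

Lemma word_ratio_le1 w : word_ratio c w <= 1.
Proof.
apply: prodr_ile1 => i.
by case/andP: (c01 i) => /ltW -> /ltW ->.
Qed.

Lemma word_ratio_rcons w i : word_ratio c (rcons w i) = word_ratio c w * c i.
Proof. by rewrite /word_ratio big_rcons /= mulrC. Qed.

Lemma word_map_edist w x y :
  edist (word_map w x) (word_map w y) = word_ratio c w * edist x y.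
Proof.
elim: w => [|i w IH] /=; first by rewrite /word_ratio big_nil mul1r.
rewrite /simil edistDr edistZ; last by case/andP: (c01 i) => /ltW.
by rewrite edist_orth// IH mulrA /word_ratio big_cons.
Qed.

Lemma word_lin_edist0 w x :
  edist (word_lin c M w *m x) 0 = word_ratio c w * edist x 0.
Proof.
by rewrite -[x in LHS]subr0 -word_map_sub -edist_sub0 word_map_edist.
Qed.

(** The product of all the ratios lies below each of them, and it serves for an empty family too. *)
Lemma ratio_lb : exists2 a : R, 0 < a <= 1 & forall i, a <= c i.
Proof.
exists (\prod_i c i) => [|i].
  apply/andP; split; first by apply: prodr_gt0 => i _; case/andP: (c01 i).
  by apply: prodr_ile1 => i; case/andP: (c01 i) => /ltW -> /ltW ->.
rewrite (bigD1 i)//= ger_pMr; last by case/andP: (c01 i).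
by apply: prodr_ile1 => j; case/andP: (c01 j) => /ltW -> /ltW ->.
Qed.

(** The product of the numbers 1 - c_i bounds each of them from below. *)
Lemma ratio_ub : exists2 r : R, 0 <= r < 1 & forall i, c i <= r.
Proof.
have c1 i : 0 < 1 - c i <= 1.
  by case/andP: (c01 i) => c0 c1; rewrite subr_gt0 c1 gerBl ltW.
exists (1 - \prod_i (1 - c i)) => [|i].
  rewrite subr_ge0 gtrBl; apply/andP; split.
    by apply: prodr_ile1 => i; case/andP: (c1 i) => /ltW -> ->.
  by apply: prodr_gt0 => i _; case/andP: (c1 i).
rewrite lerBrDr -lerBrDl (bigD1 i)//= ger_pMr; last by case/andP: (c1 i).
by apply: prodr_ile1 => j; case/andP: (c1 j) => /ltW -> ->.
Qed.

(** If every c_i is at most r and r^L <= 1/2, a word of length at least L(k+1) has ratio at most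
    2^-(k+1). *)
Lemma size_word_lt :
  exists L, forall k w, 2 ^- k.+1 < word_ratio c w -> (size w < L * k.+1)%N.
Proof.
have [r /andP[r0 r1] cr] := ratio_ub.
have [L rL] : exists L, r ^+ L <= 2^-1.
  have /cvgrPdist_le/(_ 2^-1) : (fun n => r ^+ n) @ \oo --> (0 : R).
    by apply: cvg_expr; rewrite ger0_norm.
  rewrite invr_gt0 => /(_ (ltr0n _ _))[L _ /(_ L (leqnn _))] /=.
  by rewrite sub0r normrN ger0_norm ?exprn_ge0//; exists L.
exists L => k w; apply: contraTT; rewrite -leqNgt -leNgt => Lk.
rewrite (@le_trans _ _ (r ^+ size w))//.
  elim: w {Lk} => [|i w IH]; first by rewrite /word_ratio big_nil.
  rewrite /word_ratio big_cons exprS ler_pM//.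
    by case/andP: (c01 i) => /ltW.
  exact/ltW/word_ratio_gt0.
rewrite -(subnK Lk) exprD (@le_trans _ _ (r ^+ (L * k.+1)))//.
  by rewrite ler_piMl ?exprn_ge0// exprn_ile1// ltW.
by rewrite exprM -exprVn lerXn2r// nnegrE ?exprn_ge0.
Qed.

Fixpoint words n : seq (seq I) :=
  if n is n'.+1 then [seq i :: w | i <- enum I, w <- words n'] else [:: [::]].

Lemma mem_words w : w \in words (size w).
Proof.
elim: w => //= i w IH.
by apply: (allpairs_f (fun i w => i :: w)) => //; rewrite mem_enum.
Qed.

Lemma sum_words (s : R) n : \sum_i c i `^ s = 1 ->
  \sum_(w <- words n) word_ratio c w `^ s = 1.
Proof.
move=> cs1; elim: n => [|n IH] /=.
  by rewrite big_seq1 /word_ratio big_nil powR1.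
rewrite big_allpairs_dep /= big_enum /= -[RHS]cs1; apply: eq_bigr => i _.
rewrite -[RHS]mulr1 -IH mulr_sumr; apply: eq_bigr => w _.
rewrite /word_ratio big_cons powRM//; first by case/andP: (c01 i) => /ltW.
exact/ltW/word_ratio_gt0.
Qed.

(** Among the words of one length the weights c_w^s sum to 1, and each word counted here weighs at
    least 2^-((k+1)s). Only [L * k.+1] lengths occur; this polynomial factor is the price of
    counting length by length instead of along a stopping antichain. *)
Lemma long_words_count (s : R) : 0 <= s -> \sum_i c i `^ s = 1 ->
  exists L, forall k, exists ws : seq (seq I),
    (forall w, 2 ^- k.+1 < word_ratio c w -> w \in ws) /\
    (size ws)%:R <= L%:R * k.+1%:R * 2 `^ (k.+1%:R * s).
Proof.
move=> s0 cs1; have [L Lw] := size_word_lt; exists L => k.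
pose good w := 2 ^- k.+1 < word_ratio c w.
exists (flatten [seq [seq w <- words n | good w] | n <- iota 0 (L * k.+1)]).
split=> [w gw|].
  apply/flatten_mapP; exists (size w).
    by rewrite mem_iota add0n Lw.
  by rewrite mem_filter /good gw mem_words.
have cnt n : (size [seq w <- words n | good w])%:R <= 2 `^ (k.+1%:R * s).
  rewrite -sum1_size natr_sum big_filter.
  have -> : 2 `^ (k.+1%:R * s) =
      2 `^ (k.+1%:R * s) * \sum_(w <- words n) word_ratio c w `^ s.
    by rewrite sum_words// mulr1.
  rewrite mulr_sumr [leRHS](bigID good)/= ler_wpDr//.
    by apply: sumr_ge0 => w _; rewrite mulr_ge0 ?powR_ge0.
  apply: ler_sum => w; rewrite /good -pow2Vn => /ltW gw.
  rewrite [leLHS](_ : _ = 2 `^ (k.+1%:R * s - k.+1%:R * s));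
    last by rewrite subrr powRr0.
  rewrite pow2D ler_pM2l ?pow2_gt0//.
  rewrite -mulNr powRrM ge0_ler_powR// nnegrE ?powR_ge0//.
  exact/ltW/word_ratio_gt0.
rewrite -natrM -{2}(size_iota 0 (L * k.+1)).
elim: (iota _ _) => [|n ns IH] /=; first by rewrite mul0r.
by rewrite size_cat natrD -natr1 mulrDl mul1r addrC lerD.
Qed.

Lemma words_k_exists w : exists k,
  2 ^- k.+1 < word_ratio c w /\ word_ratio c w <= 2 ^- k.
Proof.
have kw : exists k, 2 ^- k.+1 < word_ratio c w.
  have w0 := word_ratio_gt0 w.
  exists (Num.truncn (word_ratio c w)^-1).
  rewrite -[ltRHS]invrK ltf_pV2 ?posrE ?exprn_gt0 ?invr_gt0//.
  apply: lt_le_trans (truncnS_gt _) _.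
  by rewrite -natrX ler_nat ltnW// ltn_expl.
case: (ex_minnP kw) => k wk kmin; exists k; split => //.
case: k wk kmin => [|k] wk kmin; first by rewrite expr0 invr1 word_ratio_le1.
by rewrite leNgt; apply/negP => /kmin; rewrite ltnn.
Qed.

(** The word is extended letter by letter until the point comes from C or the ratio drops to [tau];
    a single letter costs at most the factor [a], whence the lower bound. If neither happened there
    would be words of every length with ratio above [tau], against the decay of the ratios. *)
Lemma attractor_stopping F C (a tau : R) :
  F = \bigcup_(i in [set: I]) (simil (c i) (M i) (b i) @` F) `|` C ->
  0 < a <= 1 -> (forall i, a <= c i) -> 0 < tau <= 1 ->
  forall y, F y -> exists w,
    (exists2 x, C x & y = word_map w x) /\ tau < word_ratio c w \/
    (exists2 x, F x & y = word_map w x) /\ a * tau <= word_ratio c w <= tau.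
Proof.
move=> FE /andP[a0 a1] ac /andP[tau0 tau1] y Fy.
apply: contrapT => /forallNP nw.
have long n : exists w, [/\ size w = n, exists2 x, F x & y = word_map w x &
    tau < word_ratio c w].
  elim: n => [|n [w [wn [x Fx yx] tw]]].
    exists [::]; split => //; first by exists y.
    rewrite /word_ratio big_nil ltNge; apply/negP => t1; apply: (nw [::]); right.
    split; first by exists y.
    by rewrite /word_ratio big_nil t1 andbT mulr_ile1// 1?ltW.
  have /seteqP[/(_ x Fx)[[i _ [x' Fx' xx']]|Cx] _] := FE; last first.
    by exfalso; apply: (nw w); left; split => //; exists x.
  have yx' : exists2 x, F x & y = word_map (rcons w i) x.
    by exists x' => //; rewrite yx -cats1 word_map_cat /= xx'.
  exists (rcons w i); split; [by rewrite size_rcons wn|by []|].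
  rewrite ltNge; apply/negP => wt; apply: (nw (rcons w i)); right; split => //.
  by rewrite wt andbT word_ratio_rcons mulrC ler_pM// ltW.
have [L Lw] := size_word_lt.
have [k tk] : exists k, 2 ^- k.+1 < tau.
  exists (Num.truncn tau^-1).
  rewrite -[ltRHS]invrK ltf_pV2 ?posrE ?exprn_gt0 ?invr_gt0//.
  apply: lt_le_trans (truncnS_gt _) _.
  by rewrite -natrX ler_nat ltnW// ltn_expl.
have [w [wL _ tw]] := long (L * k.+1)%N.
by have := Lw _ _ (lt_trans tk tw); rewrite wL ltnn.
Qed.

Lemma attractor_word F w x :
  \bigcup_(i in [set: I]) (simil (c i) (M i) (b i) @` F) `<=` F ->
  F x -> F (word_map w x).
Proof.
move=> FS; elim: w => //= i w IH /IH Fw; apply: FS.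
by exists i => //; exists (word_map w x).
Qed.

End Words.

(** * Lower bounds for covers of a set containing separated copies of itself *)

Section HausdorffLowerBound.
Variables (R : realType) (d : nat).
Local Notation pt := 'cV[R]_d.
Implicit Types (A F : set pt) (t : R).

(* Rescaling by [f k] the members of a cover by small sets that meet
   [f k @` F] covers [F] with fewer sets, whence an induction on their number. *)
Lemma separated_cover_sum (K : finType) (f : K -> pt -> pt) (r : K -> R)
    (rho t : R) F : F !=set0 -> 0 < rho -> 0 <= t -> (1 < #|K|)%N ->
  (forall k, 0 < r k) ->
  (forall k x y, edist (f k x) (f k y) = r k * edist x y) ->
  (forall k x, F x -> F (f k x)) ->
  (forall k l x y, F x -> F y -> k != l -> rho <= edist (f k x) (f l y)) ->
  1 <= \sum_k r k `^ t ->
  forall (J : finType) (P : {set J}) (U : J -> set pt) (u : J -> R),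
    (forall j, 0 <= u j) -> (forall j, diam_le (U j) (u j)) ->
    (forall x, F x -> exists2 j, j \in P & U j x) ->
    rho `^ t <= \sum_(j in P) u j `^ t.
Proof.
move=> [x0 Fx0] rho0 t0 K1 r0 fr fF fsep rt J P.
have [n] := ubnP #|P|; elim: n => // n IH in P *.
rewrite ltnS => Pn U u u0 Ud UF.
have [/existsP[j /andP[Pj uj]]|/existsPn small] :=
    boolP [exists j, (j \in P) && (rho <= u j)].
  rewrite (bigD1 j)//=; apply: ler_wpDr.
    by apply: sumr_ge0 => ? _; exact: powR_ge0.
  by apply: ge0_ler_powR => //; rewrite nnegrE ?u0 ?(ltW rho0).
have {}small j : j \in P -> u j < rho.
  by move=> Pj; have := small j; rewrite Pj /= -ltNge.
(* A set of diameter below [rho] cannot meet the images of [F] under two different maps, so these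
   index sets are pairwise disjoint. *)
pose Jk k := [set j in P | `[< exists2 x, F x & U j (f k x) >]].
have Jdisj k l j : j \in Jk k -> j \in Jk l -> k = l.
  rewrite !inE => /andP[Pj /asboolP[x Fx Ux]] /andP[_ /asboolP[y Fy Uy]].
  apply/eqP; apply: contraTT (small j Pj) => kl.
  by rewrite -leNgt (le_trans (fsep _ _ _ _ Fx Fy kl))// Ud.
have JkE k x : F x -> exists2 j, j \in Jk k & U j (f k x).
  move=> Fx; have [j Pj Uj] := UF _ (fF k _ Fx).
  by exists j => //; rewrite inE Pj; apply/asboolP; exists x.
have Jklt k : (#|Jk k| < n)%N.
  apply: leq_trans Pn; apply: proper_card; apply/fintype.properP; split.
    by apply/fintype.subsetP => j; rewrite inE => /andP[].
  (* Two maps are needed here: [Jk l] is non-empty and disjoint from [Jk k], so the latter misses an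
     element of [P] and the induction applies. *)
  have [l kl] : exists l, l != k.
    apply/existsP; move: K1; apply: contraLR => /existsPn Kk.
    rewrite -leqNgt -(card1 k) subset_leq_card//.
    by apply/fintype.subsetP => l _; rewrite inE; have := Kk l; rewrite negbK.
  have [j Jlj _] := JkE l _ Fx0; exists j.
    by move: Jlj; rewrite inE => /andP[].
  by apply: contra kl => Jkj; rewrite (Jdisj _ _ _ Jlj Jkj).
have step k : r k `^ t * rho `^ t <= \sum_(j in Jk k) u j `^ t.
  have := IH (Jk k) (Jklt k) (fun j => [set x | U j (f k x)])
    (fun j => u j / r k).
  have -> : \sum_(j in Jk k) (u j / r k) `^ t
      = (r k `^ t)^-1 * \sum_(j in Jk k) u j `^ t.
    rewrite mulr_sumr; apply: eq_bigr => j _.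
    have rk : r k `^ t != 0 by rewrite gt_eqF// powR_gt0.
    apply: (mulIf rk); rewrite -powRM ?divr_ge0 ?(ltW (r0 k))//.
    by rewrite divfK ?gt_eqF// mulrAC mulVf// mul1r.
  rewrite ler_pdivlMl ?powR_gt0//; apply => //.
  - by move=> j; rewrite divr_ge0// ltW.
  - move=> j x y /= Ux Uy; rewrite ler_pdivlMr// mulrC -fr.
    exact: Ud.
  - by move=> x /(JkE k).
apply: (@le_trans _ _ (\sum_k \sum_(j in Jk k) u j `^ t)).
  apply: (@le_trans _ _ (\sum_k r k `^ t * rho `^ t)).
    by rewrite -mulr_suml ler_peMl ?powR_ge0.
  by apply: ler_sum => k _; exact: step.
rewrite (exchange_big_dep (mem P))/=; last by move=> k j _; rewrite inE => /andP[].
apply: ler_sum => j Pj.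
have [/existsP[k Jkj]|/existsPn nJ] := boolP [exists k, j \in Jk k].
  rewrite (big_pred1 k)// => l; apply/idP/eqP => [Jlj|->//].
  exact: Jdisj Jlj Jkj.
by rewrite big_pred0 ?powR_ge0// => k; exact/negbTE.
Qed.

Lemma diam_le_diam (U : set pt) (e : R) x y : diam_le U e -> U x -> U y ->
  edist x y <= diam U.
Proof.
move=> Ue Ux Uy; apply: ub_le_sup; last by exists x => //; exists y.
by exists e => _ [x' Ux' [y' Uy' <-]]; exact: Ue.
Qed.

(** From x + y <= 2 max(x, y); the factor is there because subadditivity fails for t > 1. *)
Lemma powR_addl_le (x y t : R) : 0 <= x -> 0 <= y -> 0 <= t ->
  (x + y) `^ t <= 2 `^ t * (x `^ t + y `^ t).
Proof.
move=> x0 y0 t0; wlog xy : x y x0 y0 / x <= y.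
  move=> H; have [/H|/ltW/H] := leP x y; first exact.
  by rewrite addrC (addrC (_ `^ _)); exact.
apply: (@le_trans _ _ ((2 * y) `^ t)).
  by rewrite ge0_ler_powR// ?nnegrE ?addr_ge0 ?mulr_ge0// mulr_natl lerD2r.
by rewrite powRM// ler_wpM2l ?powR_ge0// lerDr powR_ge0.
Qed.

(** Each set of a countable cover is thickened to an open set at summable cost, and compactness then
    leaves finitely many of them. *)
Lemma hausdorff_eq0_cover A t (e : R) : A !=set0 -> compact A -> 0 <= t ->
  hausdorff t A = 0%E -> 0 < e ->
  exists N (U : 'I_N -> set pt) (u : 'I_N -> R),
    [/\ forall j, 0 <= u j, forall j, diam_le (U j) (u j),
        forall x, A x -> exists j, U j x & \sum_j u j `^ t < e].
Proof.
move=> [x0 Ax0] cA t0 hA e0.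
(* One [e1] pays for the diameters and one for the thickening, both multiplied by the factor 2^t of
   [powR_addl_le]. *)
pose e1 := e / (2 `^ t * 2); have e10 : 0 < e1.
  by rewrite divr_gt0// mulr_gt0// powR_gt0.
have : (hausdorff_delta t 1 A < (Num.min 1 e1)%:E)%E.
  apply: (@le_lt_trans _ _ 0%E); last by rewrite lte_fin lt_min ltr01.
  by rewrite -hA; apply: ereal_sup_ubound; exists 1 => //=.
move=> /ereal_inf_lt[_ [U [AU U1] <-]] Usum.
have dp0 n : 0 <= diam_pow (U n) t.
  by rewrite /diam_pow; case: ifP => // _; exact: powR_ge0.
have psum N : \sum_(n < N) diam_pow (U n) t < Num.min 1 e1.
  rewrite -lte_fin; apply: le_lt_trans Usum.
  rewrite -sumEFin -(big_mkord xpredT (fun n => (diam_pow (U n) t)%:E)).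
  by apply: nneseries_lim_ge => n _ _; rewrite lee_fin.
(* For t = 0 every non-empty set contributes 1, which the minimum with 1 in the bound excludes; t-th
   roots may then be taken. *)
have {}t0 : 0 < t.
  rewrite lt_neqAle t0 andbT eq_sym; apply/eqP => t00.
  have [n _ Un] := AU _ Ax0; have := psum n.+1; apply/negP.
  rewrite -leNgt ge_min; apply/orP; left; rewrite big_ord_recr/= ler_wpDl//.
    exact: sumr_ge0.
  rewrite /diam_pow t00 powRr0; case: asboolP => // nU.
  by exfalso; apply: nU; exists x0.
pose eps n := (e1 / 2 ^+ n.+1) `^ t^-1.
have eps0 n : 0 < eps n by rewrite powR_gt0// divr_gt0// exprn_gt0.
pose D n := if `[< U n !=set0 >] then diam (U n) else 0.
have DE n x y : U n x -> U n y -> edist x y <= D n.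
  move=> Ux Uy; rewrite /D; case: asboolP => [_|]; last by case; exists x.
  exact: diam_le_diam (U1 n) _ _.
have D0 n : 0 <= D n.
  rewrite /D; case: asboolP => // -[x Ux].
  exact: le_trans (edist_ge0 x x) (diam_le_diam (U1 n) Ux Ux).
have Dt n : D n `^ t = diam_pow (U n) t.
  by rewrite /D /diam_pow; case: asboolP => // _; rewrite powR0// gt_eqF.
pose V n := \bigcup_(x in U n) [set y | edist x y < eps n / 2].
have oV n : open (V n) by apply: bigcup_open => x _; exact: open_edist_ball.
have AV : A `<=` \bigcup_(n in [set: nat]) V n.
  move=> x /AU[n _ Ux]; exists n => //; exists x => //=.
  by rewrite edistxx divr_gt0.
move: cA; rewrite compact_cover => /(_ nat setT V (fun n _ => oV n) AV).
move=> [E _ AE].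
pose N := (\max_(n <- enum_fset E) n).+1.
exists N, (fun n => V n), (fun n => D n + eps n); split.
- by move=> j; rewrite addr_ge0// ltW.
- move=> j x y [x' Ux' /= xx'] [y' Uy' /= yy'].
  apply: le_trans (edist_triangle x' _ _) _.
  apply: (@le_trans _ _ (eps j / 2 + (D j + eps j / 2))).
    rewrite lerD//; first by rewrite edistC ltW.
    by apply: le_trans (edist_triangle y' _ _) _; rewrite lerD ?DE// ltW.
  by rewrite addrCA -splitr.
- move=> x /AE[n /= nE Vx].
  have nN : (n < N)%N by rewrite ltnS; apply: leq_bigmax_seq.
  by exists (Ordinal nN).
apply: (@le_lt_trans _ _ (2 `^ t * \sum_(n < N) (diam_pow (U n) t + e1 / 2 ^+ n.+1))).
  rewrite mulr_sumr; apply: ler_sum => n _.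
  apply: le_trans (powR_addl_le (D0 n) (ltW (eps0 n)) (ltW t0)) _.
  rewrite Dt /eps -powRrM mulVf ?gt_eqF// powRr1// ltW//.
  by rewrite divr_gt0// exprn_gt0.
rewrite big_split /= -mulr_sumr.
have -> : \sum_(n < N) (2 ^+ n.+1)^-1 = 1 - 2 ^- N :> R.
  elim: N => [|m IH]; first by rewrite big_ord0 expr0 invr1 subrr.
  by rewrite big_ord_recr /= IH exprS; field; rewrite expf_neq0.
have : e = 2 `^ t * (e1 + e1).
  by rewrite /e1; field; rewrite gt_eqF// powR_gt0.
move=> ->; rewrite ltr_pM2l ?powR_gt0// ltr_leD//.
  by apply: lt_le_trans (psum N) _; rewrite ge_min lexx orbT.
by rewrite ler_piMr ?(ltW e10)// gerBl invr_ge0 exprn_ge0.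
Qed.

End HausdorffLowerBound.

(** * Covering numbers of the homogeneous attractor *)

Section SelfSimilar.
Variables (R : realType) (d : nat) (I : finType).
Variables (c : I -> R) (M : I -> 'M[R]_d) (b : I -> 'cV[R]_d).
Hypothesis c01 : forall i, 0 < c i < 1.
Hypothesis oM : forall i, orthogonal_mx (M i).
Variable F0 : set 'cV[R]_d.
Hypothesis F0_neq0 : F0 !=set0.
Hypothesis F0_compact : compact F0.
Hypothesis F0E : F0 = \bigcup_(i in [set: I]) (simil (c i) (M i) (b i) @` F0).

Lemma self_similar_stopping (a : R) n : 0 < a <= 1 -> (forall i, a <= c i) ->
  forall y, F0 y -> exists w, (exists2 x, F0 x & y = word_map c M b w x) /\
    a * 2 ^- n <= word_ratio c w <= 2 ^- n.
Proof.
move=> a01 ac y Fy; have F0E' := F0E; rewrite -[RHS]setU0 in F0E'.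
have n01 : 0 < (2 ^- n : R) <= 1.
  by rewrite invr_gt0 exprn_gt0//= invf_le1 ?exprn_gt0// exprn_ege1// ler1n.
have [w [[[x []]]|//]] := attractor_stopping c01 F0E' a01 ac n01 Fy.
by move=> yw; exists w.
Qed.

(** Separation is obtained by selecting points. With e = 2^-n, each point of a 3De-separated subset
    of F_0 lies in a copy S_w(F_0) of diameter at most De, so these copies are De apart; more than
    (ae)^-t of them would make the sum of c_w^t at least 1 and contradict H^t(F_0) = 0. A maximal
    such subset is a net. *)
Lemma self_similar_coded (t : R) : 0 <= t -> hausdorff t F0 = 0%E ->
  exists2 K : R, 1 <= K &
    forall n, coded F0 id (K * 2 ^- n) (K * 2 `^ (n%:R * t)).
Proof.
move=> t0 hF.
have [a a01 ac] := ratio_lb c01; have /andP[a0 a1] := a01.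
have [x0 Fx0] := F0_neq0.
have [D D0 FD] : exists2 D : R, 0 < D & forall x y, F0 x -> F0 y -> edist x y <= D.
  have [D D0 FD] := compact_edist_bounded 0 F0_compact.
  exists (D + D) => [|x y Fx Fy]; first by rewrite addr_gt0.
  apply: le_trans (edist_triangle 0 _ _) _.
  by rewrite (edistC x) lerD ?FD.
have FS : \bigcup_(i in [set: I]) (simil (c i) (M i) (b i) @` F0) `<=` F0.
  by rewrite -F0E.
(* The first entry bounds the number of points of the net, the second the diameter of balls of
   radius 3De; the 1 ensures K >= 1. *)
exists (Num.max (a `^ (- t)) (3 * D + 3 * D + 1)) => [|n].
  by rewrite le_max; apply/orP; right; rewrite lerDr addr_ge0// mulr_ge0// ltW.
pose e := 2 ^- n : R; have e0 : 0 < e by rewrite invr_gt0 exprn_gt0.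
pose sep m := exists p : nat -> 'cV[R]_d, (forall i, (i < m)%N -> F0 (p i)) /\
  forall i j, (i < m)%N -> (j < m)%N -> i != j -> 3 * D * e < edist (p i) (p j).
(* This is (ae)^-t: that many ratios, each at least ae, have t-th powers of sum at least 1. *)
pose B := a `^ (- t) * 2 `^ (n%:R * t).
have B1 : 1 <= B.
  apply: mulr_ege1; last first.
    by rewrite -[leLHS](powRr0 2) pow2_le// mulr_ge0.
  rewrite powRN invf_ge1 ?powR_gt0// (@le_trans _ _ (1 `^ t))//; last by rewrite powR1.
  by apply: ge0_ler_powR => //; rewrite nnegrE// ltW.
have Bae : B * (a * e) `^ t = 1.
  rewrite powRM ?(ltW a0) ?(ltW e0)// /e -pow2Vn -powRrM /B mulNr !powRN.
  rewrite mulrACA mulVf ?gt_eqF ?powR_gt0// mul1r mulfV ?gt_eqF ?pow2_gt0//.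
have sep_le m : sep m -> m%:R <= B.
  move=> [p [Fp psep]].
  (* [separated_cover_sum] needs at least two maps; otherwise [1 <= B] suffices. *)
  have [m1|m1] := leqP m 1; first by rewrite (le_trans _ B1)// lern1.
  rewrite leNgt; apply/negP => Bm.
  have /choice[w wP] : forall i, exists w, (i < m)%N ->
      (exists2 x, F0 x & p i = word_map c M b w x) /\
      a * e <= word_ratio c w <= e.
    move=> i; case: (ltnP i m) => im; last by exists [::].
    by have [w wP] := self_similar_stopping n a01 ac (Fp i im); exists w.
  have wsep (k l : 'I_m) x y : F0 x -> F0 y -> k != l ->
      D * e <= edist (word_map c M b (w k) x) (word_map c M b (w l) y).
    move=> Fx Fy kl; have := psep k l (ltn_ord k) (ltn_ord l) kl.
    have [[x' Fx' ->] /andP[_ wk]] := wP k (ltn_ord k).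
    have [[y' Fy' ->] /andP[_ wl]] := wP l (ltn_ord l).
    have near (i : 'I_m) z z' : F0 z -> F0 z' ->
        word_ratio c (w i) <= e ->
        edist (word_map c M b (w i) z) (word_map c M b (w i) z') <= D * e.
      move=> Fz Fz' we; rewrite word_map_edist// mulrC ler_pM ?edist_ge0 ?FD//.
      exact/ltW/word_ratio_gt0.
    have h1 := near k _ _ Fx' Fx wk; have h2 := near l _ _ Fy Fy' wl.
    have h3 := edist_triangle (word_map c M b (w k) x)
      (word_map c M b (w k) x') (word_map c M b (w l) y').
    have h4 := edist_triangle (word_map c M b (w l) y)
      (word_map c M b (w k) x) (word_map c M b (w l) y').
    by move=> h5; lra.
  have rho0 : 0 < D * e by rewrite mulr_gt0.
  have [N [U [u [u0 Ud UF]]]] :=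
    hausdorff_eq0_cover F0_neq0 F0_compact t0 hF (powR_gt0 t rho0).
  apply/negP; rewrite -leNgt.
  have := @separated_cover_sum R d 'I_m (fun i => word_map c M b (w i))
    (fun i => word_ratio c (w i)) (D * e) t F0 F0_neq0 rho0 t0.
  rewrite card_ord => /(_ m1 (fun k => word_ratio_gt0 c01 _)
    (fun k => word_map_edist b c01 oM _)
    (fun k x => @attractor_word _ _ _ c M b F0 (w k) x FS) wsep).
  have sumr : 1 <= \sum_(i < m) word_ratio c (w i) `^ t.
    apply: (@le_trans _ _ (\sum_(i < m) (a * e) `^ t)).
      rewrite sumr_const card_ord -[leRHS]mulr_natl -[leLHS]Bae.
      by rewrite ler_wpM2r ?powR_ge0// ltW.
    apply: ler_sum => i _; have [_ /andP[aw _]] := wP i (ltn_ord i).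
    apply: ge0_ler_powR => //; rewrite nnegrE.
      exact/ltW/mulr_gt0.
    exact/ltW/word_ratio_gt0.
  move=> /(_ sumr 'I_N [set: 'I_N]%SET U u u0 Ud).
  under eq_bigl do rewrite inE.
  by apply=> x /UF[j Uj]; exists j; rewrite ?inE.
have [m [p [Fp psep]] mmax] : exists2 m, sep m & forall m', sep m' -> (m' <= m)%N.
  have ex : exists m, `[< sep m >].
    by exists 0; apply/asboolP; exists (fun=> x0); split.
  have ub m : `[< sep m >] -> (m <= Num.truncn B)%N.
    by move=> /asboolP/sep_le mB; rewrite truncn_ge_nat// (le_trans _ B1).
  case: (ex_maxnP ex ub) => m /asboolP sm mmax; exists m => // m' sm'.
  by apply: mmax; exact/asboolP.
have /choice[f fP] : forall y, exists i, F0 y ->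
    (i < m)%N /\ edist y (p i) <= 3 * D * e.
  move=> y; have [Fy|nF] := pselect (F0 y); last by exists 0.
  apply: contrapT => /forallNP nf.
  (* A point far from every [p i] would enlarge the family, against the maximality of [m]. *)
  suff /mmax : sep m.+1 by rewrite ltnn.
  have far i : (i < m)%N -> 3 * D * e < edist y (p i).
    by move=> im; rewrite ltNge; apply/negP => yi; apply: (nf i) => _.
  exists (fun i => if i == m then y else p i); split=> [i|i j].
    by rewrite ltnS leq_eqVlt; case: eqP => //= _; exact: Fp.
  rewrite !ltnS [(i <= m)%N]leq_eqVlt [(j <= m)%N]leq_eqVlt.
  case: eqP => [->|_]; case: eqP => [->|_] //=.
  - by rewrite eqxx.
  - by move=> _ /far.
  - by move=> /far; rewrite edistC.
  - exact: psep.
exists nat, (iota 0 m), f; split.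
- rewrite size_iota (le_trans (sep_le _ (ex_intro _ p (conj Fp psep))))//.
  by rewrite ler_wpM2r ?powR_ge0// le_max lexx.
- by move=> y /fP[fm _]; rewrite mem_iota.
move=> y z /fP[_ fy] /fP[_ fz] fyz; rewrite fyz in fy.
apply: le_trans (edist_triangle (p (f z)) _ _) _.
apply: (@le_trans _ _ (3 * D * e + 3 * D * e)).
  by rewrite lerD// edistC.
rewrite -mulrDl ler_pM2r// le_max; apply/orP; right.
by rewrite lerDl.
Qed.

End SelfSimilar.

(** * Labellings of spherical shells and of grid cells *)

Section Shells.
Variables (R : realType).

(* The coordinate of largest modulus is determined, up to its sign, by the
   Euclidean norm and the other coordinates, stably so because its derivative
   with respect to them is bounded. *)
Lemma shell_close d (u v : 'cV[R]_d) (delta : R) i : 0 <= delta ->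
  (forall j, `|u j ord0| <= `|u i ord0|) ->
  (forall j, `|v j ord0| <= `|v i ord0|) ->
  (0 <= u i ord0) = (0 <= v i ord0) ->
  (forall j, j != i -> `|u j ord0 - v j ord0| <= delta) ->
  `|edist u 0 - edist v 0| <= delta ->
  edist u v <= d%:R * (2 * d%:R * delta).
Proof.
move=> d0 ui vi uvi uv nuv.
set a := `|u i ord0| in ui *; set b := `|v i ord0| in vi *.
have a0 : 0 <= a by exact: normr_ge0.
have b0 : 0 <= b by exact: normr_ge0.
have dgt0 : (0 < d)%N by apply: leq_trans (ltn_ord i).
have d1 : 1 <= d%:R :> R by rewrite ler1n.
have abE : `|u i ord0 - v i ord0| = `|a - b|.
  rewrite /a /b; have [ui0|ui0] := leP 0 (u i ord0).
    by move: uvi; rewrite ui0 => /esym vi0; rewrite (ger0_norm ui0) (ger0_norm vi0).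
  move: uvi; rewrite leNgt ui0 /= => /esym/negbT; rewrite -ltNge => vi0.
  by rewrite (ltr0_norm ui0) (ltr0_norm vi0) -opprD normrN.
have nrm (x : 'cV[R]_d) (r : R) : (forall j, `|x j ord0| <= r) -> 0 <= r ->
    edist x 0 <= d%:R * r.
  by move=> xr r0; apply: edist_le_coord => // j; rewrite !mxE subr0.
have nu := nrm _ _ ui a0; have nv := nrm _ _ vi b0.
have sqE (x : 'cV[R]_d) : edist x 0 ^+ 2 =
    `|x i ord0| ^+ 2 + \sum_(j | j != i) x j ord0 ^+ 2.
  rewrite edist_sqr (bigD1 i)//= real_normK ?num_real// !mxE subr0.
  by congr (_ + _); apply: eq_bigr => j _; rewrite !mxE subr0.
(* The norms and the other coordinates both contribute to a^2 - b^2 at most a multiple of delta (a +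
   b), since all coordinates are bounded by a or b; cancelling a + b leaves a bound independent of
   the size of u and v. *)
have main : `|a - b| * (a + b) <= (2 * d%:R * delta) * (a + b).
  rewrite -[X in _ * X <= _]ger0_norm ?addr_ge0// -normrM -subr_sqr.
  have -> : a ^+ 2 - b ^+ 2 = (edist u 0 - edist v 0) * (edist u 0 + edist v 0)
      - \sum_(j | j != i) (u j ord0 - v j ord0) * (u j ord0 + v j ord0).
    rewrite -subr_sqr !sqE -/a -/b.
    under [X in _ = _ - X]eq_bigr do rewrite -subr_sqr.
    by rewrite sumrB; ring.
  apply: le_trans (ler_normB _ _) _.
  have -> : 2 * d%:R * delta * (a + b) =
    delta * (d%:R * a + d%:R * b) + \sum_(j < d) delta * (a + b).
    by rewrite sumr_const card_ord -mulr_natl; ring.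
  apply: lerD.
    rewrite normrM ler_pM// ger0_norm ?addr_ge0 ?edist_ge0//.
    exact: lerD.
  apply: le_trans (ler_norm_sum _ _ _) _.
  rewrite [leRHS](bigID (fun j => j != i))/= ler_wpDr//.
    by apply: sumr_ge0 => j _; rewrite mulr_ge0// addr_ge0.
  apply: ler_sum => j ji; rewrite normrM ler_pM ?uv//.
  by apply: le_trans (ler_normD _ _) _; rewrite lerD.
have ab : `|a - b| <= 2 * d%:R * delta.
  have [ab0|ab0] := eqVneq (a + b) 0; last first.
    by rewrite ler_pM2r// lt_neqAle eq_sym ab0 addr_ge0 in main.
  have -> : a = 0 by lra.
  have -> : b = 0 by lra.
  by rewrite subrr normr0 !mulr_ge0.
apply: edist_le_coord => [|j]; first by rewrite !mulr_ge0.
have [->|ji] := eqVneq j i; first by rewrite abE.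
apply: le_trans (uv _ ji) _; rewrite ler_peMl//.
by rewrite -[leLHS]mulr1 ler_pM// ler1n.
Qed.

(** The label consists of the position of a largest coordinate, its sign, and the grid cells of the
    other d - 1 coordinates. The norm is not labelled: its closeness is a premise, which is why the
    exponent is d - 1. *)
Lemma shell_labelled d Z (P : set Z) (h : Z -> 'cV[R]_d) (rho delta : R) m :
  (0 < d)%N -> 0 < delta -> 2 * rho < m%:R * delta ->
  (forall z, P z -> edist (h z) 0 <= rho) ->
  labelled P (fun z z' => `|edist (h z) 0 - edist (h z') 0| <= delta ->
      edist (h z) (h z') <= d%:R * (2 * d%:R * delta))
    (d%:R * 2 * m.+1%:R ^+ d.-1 : R).
Proof.
case: d h => // d h _ d0 rm hP.
pose ix z := [arg max_(i > ord0 : 'I_d.+1) `|h z i ord0|]%O.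
have ixP z j : `|h z j ord0| <= `|h z (ix z) ord0|.
  by rewrite /ix; case: arg_maxP => //= i _; apply.
have := labelled_fin R P (fun z => (ix z, 0 <= h z (ix z) ord0,
  [ffun j : 'I_d => grid_index delta m (h z (lift (ix z) j) ord0)])).
rewrite !card_prod card_ord card_bool card_ffun !card_ord !natrM natrX.
apply: labelled_weaken => // z z' Pz Pz' [iE sE gE] nE.
apply: shell_close (ixP z) _ _ _ nE; rewrite ?(ltW d0)//.
- by rewrite iE.
- by rewrite sE iE.
move=> j; case: (unliftP (ix z) j) => [j' -> _|->]; last by rewrite eqxx.
apply: (@grid_index_inj _ _ m) => //.
  apply: le_lt_trans rm; apply: le_trans (coord_le_edist _ _ _) _.
  apply: le_trans (edist_triangle 0 _ _) _; rewrite mulr_natl mulr2n.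
  by rewrite lerD ?hP// edistC hP.
by have /ffunP/(_ j') := gE; rewrite !ffunE -iE.
Qed.

(** Cells are known only modulo [m.+1]; a coarser coding paired with this one supplies the premise
    that makes this enough. *)
Lemma grid_labelled d Z (P : set Z) (h : Z -> 'cV[R]_d) (rho delta : R) m :
  0 < delta -> rho < m%:R * delta ->
  labelled P (fun z z' => edist (h z) (h z') <= rho ->
      edist (h z) (h z') <= d%:R * delta) (m.+1%:R ^+ d : R).
Proof.
move=> d0 rm.
have := labelled_fin R P (fun z =>
  [ffun j : 'I_d => grid_index delta m (h z j ord0)]).
rewrite card_ffun !card_ord natrX; apply: labelled_weaken => // z z' Pz Pz' gE hE.
apply: edist_le_coord => [|j]; first exact: ltW.
apply: (@grid_index_inj _ _ m) => //.
  exact: le_lt_trans (le_trans (coord_le_edist _ _ _) hE) rm.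
by have /ffunP/(_ j) := gE; rewrite !ffunE.
Qed.

End Shells.

(** * The four covers of the pieces S_w(C) of a given level *)

Section Pieces.
Variables (R : realType) (d : nat) (I : finType).
Variables (c : I -> R) (M : I -> 'M[R]_d) (b : I -> 'cV[R]_d).
Hypothesis c01 : forall i, 0 < c i < 1.
Hypothesis oM : forall i, orthogonal_mx (M i).
Local Notation S := (word_map c M b).
Local Notation T := (word_lin c M).
Local Notation ratio := (word_ratio c).

Lemma le_mul_pow2 (A B K1 K2 x y : R) : 0 <= A -> 0 <= B ->
  A <= K1 * 2 `^ x -> B <= K2 * 2 `^ y -> A * B <= K1 * K2 * 2 `^ (x + y).
Proof. by move=> A0 B0 AK BK; rewrite pow2D mulrACA ler_pM. Qed.

Lemma le_const_pow2 (K x y : R) : 0 <= K -> x <= y -> K * 2 `^ x <= K * 2 `^ y.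
Proof. by move=> K0 xy; rewrite ler_wpM2l// pow2_le. Qed.

Lemma coded_uniform X Z (P : X -> set Z) (g : Z -> 'cV[R]_d) (e B : X -> R)
    (K1 K2 : R) : (forall x, 0 <= e x) -> (forall x, 0 <= B x) ->
  (forall x, coded (P x) g (K1 * e x) (K2 * B x)) ->
  exists2 K : R, 1 <= K & forall x, coded (P x) g (K * e x) (K * B x).
Proof.
move=> e0 B0 Pg; exists (Num.max 1 (Num.max K1 K2)) => [|x].
  by rewrite le_max lexx.
by apply: coded_le (Pg x); rewrite ler_wpM2r// !le_max lexx !orbT.
Qed.

Lemma word_lin_edist w x y : edist (T w *m x) (T w *m y) = ratio w * edist x y.
Proof.
by rewrite edist_sub0 -mulmxBr (word_lin_edist0 b)// -edist_sub0.
Qed.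

(** Writing S_w(z) = S_w(p) + T_w(z - p) separates position from shape: for p in F_0 the base points
    S_w(p) stay in F_0, and the linear part is handled on its own. *)
Lemma word_map_edist_le w w' p z z' : edist (S w z) (S w' z') <=
  edist (S w p) (S w' p) + edist (T w *m (z - p)) (T w' *m (z' - p)).
Proof.
have SE v x : S v x = S v p + T v *m (x - p) by rewrite -(word_map_sub c M b) addrC subrK.
by rewrite (SE w z) (SE w' z') edistD.
Qed.

(** Hence exponentially many words have only polynomially many ratios in terms of their length. *)
Lemma word_ratio_count w : ratio w = \prod_i c i ^+ count_mem i w.
Proof.
rewrite /word_ratio; elim: w => [|i w IH] /=.
  by rewrite big_nil big1.
rewrite big_cons IH; under [RHS]eq_bigr do rewrite exprD.
rewrite big_split /=; congr (_ * _); rewrite (bigD1 i)//= eqxx expr1.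
by rewrite big1 ?mulr1// => j ji; rewrite eq_sym (negbTE ji) expr0.
Qed.

Variables (s alpha beta gamma : R).
Hypothesis s_ge0 : 0 <= s.
Hypothesis sum_s : \sum_i c i `^ s = 1.
Hypothesis gamma_ge0 : 0 <= gamma.
Variables (C F0 : set 'cV[R]_d) (p : 'cV[R]_d) (D : R).
Hypothesis F0p : F0 p.
Hypothesis F0_stable :
  \bigcup_(i in [set: I]) (simil (c i) (M i) (b i) @` F0) `<=` F0.
Hypothesis D_gt0 : 0 < D.
Hypothesis C_bounded : forall z, C z -> edist z p <= D.
Hypothesis F0_coded : forall e, 0 < e -> exists2 K : R, 1 <= K &
  forall n, coded F0 id (K * 2 ^- n) (K * 2 `^ (n%:R * (alpha + e))).
Hypothesis C_coded : forall e, 0 < e -> exists2 K : R, 1 <= K &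
  forall n, coded C id (2 ^- n) (K * 2 `^ (n%:R * (beta + e))).
Hypothesis count_le : forall e, 0 < e -> exists2 K : R, 1 <= K &
  forall k, (count_lin c M k)%:R <= K * 2 `^ (k%:R * (gamma + e)).

Definition piece_params k : set (seq I * 'cV[R]_d) :=
  [set wz | [/\ 2 ^- k.+1 < ratio wz.1, ratio wz.1 <= 2 ^- k & C wz.2]].

Definition piece_map (wz : seq I * 'cV[R]_d) := S wz.1 wz.2.

Let pow2V_ge0 n : 0 <= 2 ^- n :> R. Proof. by rewrite invr_ge0 exprn_ge0. Qed.
Let pow2V_gt0 n : 0 < 2 ^- n :> R. Proof. by rewrite invr_gt0 exprn_gt0. Qed.

Let ratio_ge0 w : 0 <= ratio w. Proof. exact/ltW/word_ratio_gt0. Qed.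

Let base_coded Z (P : set Z) (w : Z -> seq I) (e N : R) :
  coded F0 id e N -> coded P (fun z => S (w z) p) e N.
Proof. by apply: coded_comp => z _; exact: attractor_word. Qed.

Let ratio_scale k j w (r : R) : ratio w <= 2 ^- k -> 0 <= r <= 2 ^- j ->
  ratio w * r <= 2 ^- (k + j).
Proof.
by move=> wk /andP[r0 rj]; rewrite exprD invfM ler_pM.
Qed.

(** The label is the word w with a code of z at scale 2^-j, which S_w contracts to 2^-(k+j). *)
Lemma piece_coded_words e : 0 < e -> exists2 K : R, 1 <= K & forall kj : nat * nat,
  coded (piece_params kj.1) piece_map (K * 2 ^- (kj.1 + kj.2))
    (K * 2 `^ (kj.1%:R * s + kj.2%:R * beta + (kj.1 + kj.2)%:R * e)).
Proof.
move=> e0; have [L Lcount] := long_words_count c01 s_ge0 sum_s.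
have [K1 K11 K1C] := C_coded e0.
have [K2 K21 K2P] := poly_le_pow2 1 e0.
have K10 : 0 <= K1 by apply: le_trans K11.
have K20 : 0 <= K2 by apply: le_trans K21.
apply: (coded_uniform (K1 := 1) (K2 := L%:R * K2 * K1 * 2 `^ s)).
- by move=> x.
- by move=> x; exact: powR_ge0.
move=> [k j] /=.
have [ws [wsP wsN]] := Lcount k.
have h1 : labelled (piece_params k) (fun wz wz' => wz.1 = wz'.1) ((size ws)%:R : R).
  by apply: (labelled_seq R (f := fst)) => wz [kw _ _]; exact: wsP.
have h2 : coded (piece_params k) snd (2 ^- j) (K1 * 2 `^ (j%:R * (beta + e))).
  by apply: coded_comp (K1C j) => wz [].
apply: labelled_weaken (labelled_and h1 h2).
  move=> [w z] [w' z'] [/= _ wk _] _ [/= <- zz']; rewrite mul1r /piece_map /=.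
  by rewrite word_map_edist// ratio_scale// edist_ge0.
apply: (@le_trans _ _ (L%:R * (K2 * 2 `^ (k%:R * e)) * 2 `^ (k.+1%:R * s)
    * (K1 * 2 `^ (j%:R * (beta + e))))).
  rewrite ler_wpM2r ?mulr_ge0 ?powR_ge0//; apply: le_trans wsN _.
  rewrite ler_wpM2r ?powR_ge0// ler_wpM2l//.
  by have := K2P k; rewrite expr1.
rewrite -[leRHS]mulrA -pow2D.
have -> : L%:R * (K2 * 2 `^ (k%:R * e)) * 2 `^ (k.+1%:R * s)
    * (K1 * 2 `^ (j%:R * (beta + e))) = L%:R * K2 * K1 *
    (2 `^ (k%:R * e) * 2 `^ (k.+1%:R * s) * 2 `^ (j%:R * (beta + e))) by ring.
rewrite -!pow2D ler_wpM2l ?mulr_ge0// pow2_le// -natr1 natrD.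
have : 0 <= k%:R * e by rewrite mulr_ge0// ltW.
have : 0 <= j%:R * e by rewrite mulr_ge0// ltW.
lra.
Qed.

Let cells_le (Q j m : nat) : ((Q * 2 ^ j).+1%:R ^+ m : R) <=
  Q.+1%:R ^+ m * 2 `^ (j%:R * m%:R).
Proof.
rewrite powRrM pow2n powR_mulrn ?exprn_ge0// -exprMn.
rewrite lerXn2r ?nnegrE// ?mulr_ge0 ?exprn_ge0//.
by rewrite -natrX -natrM ler_nat mulSn -addn1 addnC leq_add2r expn_gt0.
Qed.

Let scale_lt (x : R) k j :
  x * 2 ^- k < (((Num.truncn x).+1 * 2 ^ j)%:R) * 2 ^- (k + j).
Proof.
have -> : (((Num.truncn x).+1 * 2 ^ j)%:R) * 2 ^- (k + j) =
    (Num.truncn x).+1%:R * 2 ^- k :> R.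
  by rewrite natrM natrX exprD; field; rewrite !expf_neq0.
by rewrite ltr_pM2r// truncnS_gt.
Qed.

(** S_w(z) is within D 2^-k of the point S_w(p) of F_0: the label is a code of S_w(p) at scale 2^-k,
    then a cell of side 2^-(k+j) in the whole space. *)
Lemma piece_coded_ambient e : 0 < e -> exists2 K : R, 1 <= K & forall kj : nat * nat,
  coded (piece_params kj.1) piece_map (K * 2 ^- (kj.1 + kj.2))
    (K * 2 `^ (kj.1%:R * alpha + kj.2%:R * d%:R + (kj.1 + kj.2)%:R * e)).
Proof.
move=> e0; have [K1 K11 K1F] := F0_coded e0.
have K10 : 0 <= K1 by apply: le_trans K11.
pose rho := 2 * D + K1; pose Q := (Num.truncn rho).+1.
apply: (coded_uniform (K1 := d%:R) (K2 := K1 * Q.+1%:R ^+ d)).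
- by move=> x.
- by move=> x; exact: powR_ge0.
move=> [k j] /=.
have h1 := base_coded (piece_params k) fst (K1F k).
have h2 := grid_labelled (piece_params k) piece_map (pow2V_gt0 (k + j))
  (scale_lt rho k j).
apply: labelled_weaken (labelled_and h1 h2).
  move=> [w z] [w' z'] [/= _ wk Cz] [/= _ wk' Cz'] [/= ww']; apply.
  apply: le_trans (edist_triangle (S w p) _ _) _.
  apply: (@le_trans _ _ (2 ^- k * D + (K1 * 2 ^- k + 2 ^- k * D))).
    rewrite lerD//.
      by rewrite /piece_map word_map_edist// ler_pM ?edist_ge0 ?C_bounded.
    apply: le_trans (edist_triangle (S w' p) _ _) _; rewrite lerD//.
    by rewrite /piece_map word_map_edist// ler_pM ?edist_ge0// edistC C_bounded.
  by rewrite /rho le_eqVlt; apply/orP; left; apply/eqP; ring.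
have := le_mul_pow2 _ _ (lexx (K1 * 2 `^ (k%:R * (alpha + e)))) (cells_le Q j d).
move=> /(_ _ _)/le_trans; apply; rewrite ?mulr_ge0 ?exprn_ge0 ?powR_ge0//.
apply: le_const_pow2; first by rewrite mulr_ge0 ?exprn_ge0.
have : 0 <= j%:R * e by rewrite mulr_ge0// ltW.
by rewrite natrD; lra.
Qed.

(** Four labels: the letter counts of w, S_w(p) at scale 2^-(k+j), z at scale 2^-j, and the cell of
    T_w(z - p) on its shell. The first and third fix the radius of the shell up to 2^-(k+j), so the
    last costs only 2^(j(d-1)) up to a constant, whatever the rotations. *)
Lemma piece_coded_rotations e : (0 < d)%N -> 0 < e ->
  exists2 K : R, 1 <= K & forall kj : nat * nat,
  coded (piece_params kj.1) piece_map (K * 2 ^- (kj.1 + kj.2))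
    (K * 2 `^ ((kj.1 + kj.2)%:R * alpha + kj.2%:R * (beta + d%:R - 1)
      + (kj.1 + kj.2)%:R * e)).
Proof.
(* One third of the loss each for alpha, for beta and for the number of letter counts. *)
move=> d_gt0 e0; have e30 : 0 < e / 3 by rewrite divr_gt0.
have [L Lw] := size_word_lt c01.
have [K1 K11 K1F] := F0_coded e30.
have [K2 K21 K2C] := C_coded e30.
have [K3 K31 K3P] := poly_le_pow2 #|I| e30.
have K10 : 0 <= K1 by apply: le_trans K11.
have K20 : 0 <= K2 by apply: le_trans K21.
have K30 : 0 <= K3 by apply: le_trans K31.
pose Q := (Num.truncn (2 * D)).+1.
apply: (coded_uniform (K1 := K1 + d%:R * (2 * d%:R))
  (K2 := (L.+1%:R ^+ #|I| * K3) * K1 * K2 * (d%:R * 2 * Q.+1%:R ^+ d.-1))).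
- by move=> x.
- by move=> x; exact: powR_ge0.
move=> [k j] /=.
have h1 := labelled_fin R (piece_params k) (fun wz : seq I * 'cV[R]_d =>
  [ffun i => inord (count_mem i wz.1) : 'I_(L * k.+1).+1]).
have h2 := base_coded (piece_params k) fst (K1F (k + j)%N).
have h3 : coded (piece_params k) snd (2 ^- j) (K2 * 2 `^ (j%:R * (beta + e / 3))).
  by apply: coded_comp (K2C j) => wz [].
have lt_rho : 2 * (2 ^- k * D) < (Q * 2 ^ j)%:R * 2 ^- (k + j).
  by have := scale_lt (2 * D) k j; rewrite (mulrC (2 ^- k)) mulrA.
have h4 : labelled (piece_params k) _ _ := shell_labelled
  (h := fun wz => T wz.1 *m (wz.2 - p)) d_gt0 (pow2V_gt0 (k + j)) lt_rho _.
apply: labelled_weaken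
  (labelled_and (labelled_and h1 h2) (labelled_and h3 (h4 _))).
- move=> [w z] [w' z'] [/= wk0 wk Cz] [/= wk0' wk' Cz'] [/= [cE ww'] [zz']].
  (* A letter count is at most the length of the word, which is below [L * k.+1], so [inord] loses
     nothing. *)
  have rE : ratio w = ratio w'.
    rewrite !word_ratio_count; apply: eq_bigr => i _; congr (_ ^+ _).
    have /ffunP/(_ i) := cE; rewrite !ffunE => /(congr1 val) /=.
    by rewrite !inordK ?ltnS// (leq_trans (count_size _ _))// ltnW ?Lw.
  have near_norm : `|edist (T w *m (z - p)) 0 - edist (T w' *m (z' - p)) 0|
      <= 2 ^- (k + j).
    rewrite !(word_lin_edist0 b)// -!edist_sub0 -rE -mulrBr normrM ger0_norm//.
    apply: ratio_scale => //; rewrite normr_ge0/=; apply: le_trans zz'.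
    rewrite ler_norml lerBDr lerBlDr; apply/andP; split.
      rewrite addrC lerBlDr; apply: le_trans (edist_triangle z _ _) _.
      by rewrite addrC (edistC z').
    exact: edist_triangle.
  move=> /(_ near_norm) TT; rewrite /piece_map /=.
  apply: le_trans (word_map_edist_le w w' p z z') _.
  by rewrite mulrDl lerD// -mulrA.
- have cnt : #|{ffun I -> 'I_(L * k.+1).+1}|%:R <=
      L.+1%:R ^+ #|I| * K3 * 2 `^ (k%:R * (e / 3)).
    rewrite card_ffun card_ord natrX -mulrA.
    apply: (@le_trans _ _ (L.+1%:R ^+ #|I| * k.+1%:R ^+ #|I|)); last first.
      by rewrite ler_wpM2l ?exprn_ge0// K3P.
    rewrite -exprMn lerXn2r ?nnegrE// -natrM ler_nat mulSn -addn1 addnC.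
    by rewrite leq_add2r.
  apply: (@le_trans _ _ (
    (L.+1%:R ^+ #|I| * K3 * 2 `^ (k%:R * (e / 3)) *
     (K1 * 2 `^ ((k + j)%:R * (alpha + e / 3)))) *
    ((K2 * 2 `^ (j%:R * (beta + e / 3))) *
     (d%:R * 2 * (Q.+1%:R ^+ d.-1 * 2 `^ (j%:R * d.-1%:R)))))).
    apply: ler_pM; rewrite ?mulr_ge0 ?exprn_ge0 ?powR_ge0//.
      by rewrite ler_wpM2r ?mulr_ge0 ?powR_ge0.
    by rewrite !ler_wpM2l ?mulr_ge0 ?powR_ge0.
  rewrite [leLHS](_ : _ = L.+1%:R ^+ #|I| * K3 * K1 * K2 *
      (d%:R * 2 * Q.+1%:R ^+ d.-1) *
    (2 `^ (k%:R * (e / 3)) * 2 `^ ((k + j)%:R * (alpha + e / 3)) *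
     2 `^ (j%:R * (beta + e / 3)) * 2 `^ (j%:R * d.-1%:R))); last by ring.
  rewrite -!pow2D; apply: le_const_pow2.
    by rewrite !mulr_ge0 ?exprn_ge0.
  have : 0 <= k%:R * e by rewrite mulr_ge0// ltW.
  have : 0 <= j%:R * e by rewrite mulr_ge0// ltW.
  have -> : d.-1%:R = d%:R - 1 :> R by rewrite -subn1 natrB.
  by rewrite natrD; lra.
- move=> [w z] [/= _ wk Cz]; rewrite (word_lin_edist0 b)// -edist_sub0.
  by rewrite ler_pM ?edist_ge0 ?C_bounded.
Qed.

(** Pieces with the same T_w are translates of each other, so T_w, S_w(p) at scale 2^-(k+j) and z at
    scale 2^-j locate S_w(z). *)
Lemma piece_coded_linear e : 0 < e ->
  exists2 K : R, 1 <= K & forall kj : nat * nat,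
  coded (piece_params kj.1) piece_map (K * 2 ^- (kj.1 + kj.2))
    (K * 2 `^ ((kj.1 + kj.2)%:R * alpha + kj.1%:R * gamma + kj.2%:R * beta
      + (kj.1 + kj.2)%:R * e)).
Proof.
move=> e0; have e20 : 0 < e / 2 by rewrite divr_gt0.
have [K1 K11 K1F] := F0_coded e20.
have [K2 K21 K2C] := C_coded e20.
have [K3 K31 K3P] := count_le e20.
have K10 : 0 <= K1 by apply: le_trans K11.
have K20 : 0 <= K2 by apply: le_trans K21.
have K30 : 0 <= K3 by apply: le_trans K31.
apply: (coded_uniform (K1 := K1 + 1) (K2 := (K3 + 1) * K1 * K2)).
- by move=> x.
- by move=> x; exact: powR_ge0.
move=> [k j] /=.
(* [fset_set] enumerates only finite sets; on infinite ones it is empty by default. *)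
have fin_lin : finite_set (word_lin c M @` words_k c k).
  apply: finite_image.
  have [L' /(_ k)[ws [wsP _]]] := long_words_count c01 s_ge0 sum_s.
  apply: (@sub_finite_set _ _ [set` ws]); last exact: finite_seq.
  by move=> w [_ [wk _]] /=; exact: wsP.
have h1 : labelled (piece_params k) (fun wz wz' => T wz.1 = T wz'.1)
    ((count_lin c M k)%:R + 1 : R).
  (* The identity is added for the empty word, which [words_k] leaves out; hence the summand 1. *)
  rewrite natr1; apply: (labelled_seq R (s := 1%:M :: fset_set (T @` words_k c k))
    (f := fun wz => T wz.1)).
  move=> [w z] [/= wk0 wk _]; rewrite in_cons; apply/orP.
  case: w wk0 wk => [|i w] wk0 wk; [by left|right].
  by rewrite in_fset_set//; apply/mem_set; exists (i :: w).
have h2 := base_coded (piece_params k) fst (K1F (k + j)%N).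
have h3 : coded (piece_params k) snd (2 ^- j) (K2 * 2 `^ (j%:R * (beta + e / 2))).
  by apply: coded_comp (K2C j) => wz [].
apply: labelled_weaken (labelled_and (labelled_and h1 h2) h3).
  move=> [w z] [w' z'] [/= _ wk _] _ [/= [TE ww'] zz']; rewrite /piece_map /=.
  apply: le_trans (word_map_edist_le w w' p z z') _.
  rewrite mulrDl lerD// -TE word_lin_edist edistDr mul1r.
  by rewrite ratio_scale// edist_ge0.
have cnt : (count_lin c M k)%:R + 1 <= (K3 + 1) * 2 `^ (k%:R * (gamma + e / 2)).
  rewrite mulrDl mul1r lerD//.
  rewrite -[leLHS](powRr0 2) pow2_le// mulr_ge0// addr_ge0//.
  exact: ltW.
apply: (@le_trans _ _ ((K3 + 1) * 2 `^ (k%:R * (gamma + e / 2)) *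
  (K1 * 2 `^ ((k + j)%:R * (alpha + e / 2))) *
  (K2 * 2 `^ (j%:R * (beta + e / 2))))).
  by rewrite !ler_wpM2r ?mulr_ge0 ?powR_ge0.
have -> : (K3 + 1) * 2 `^ (k%:R * (gamma + e / 2)) *
  (K1 * 2 `^ ((k + j)%:R * (alpha + e / 2))) *
  (K2 * 2 `^ (j%:R * (beta + e / 2))) = (K3 + 1) * K1 * K2 *
  (2 `^ (k%:R * (gamma + e / 2)) * 2 `^ ((k + j)%:R * (alpha + e / 2)) *
  2 `^ (j%:R * (beta + e / 2))) by ring.
rewrite -!pow2D; apply: le_const_pow2; first by rewrite !mulr_ge0 ?addr_ge0.
have : 0 <= k%:R * e by rewrite mulr_ge0// ltW.
have : 0 <= j%:R * e by rewrite mulr_ge0// ltW.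
by rewrite natrD; lra.
Qed.

(** * Copies of the attractor at the final scale, and the assembly of all covers *)

Variable FC : set 'cV[R]_d.
Hypothesis FC_bounded : forall z, FC z -> edist z p <= D.

Definition tail_params (a : R) n : set (seq I * 'cV[R]_d) :=
  [set wz | a * 2 ^- n <= ratio wz.1 <= 2 ^- n /\ FC wz.2].

(** At x = 1 the four terms are s, alpha, alpha and alpha + gamma, so the final copies of F_C are
    counted both with exponent s and with exponent alpha; here word by word. *)
Lemma tail_coded_words a e : 0 < a -> 0 < e -> exists2 K : R, 1 <= K &
  forall n, coded (tail_params a n) piece_map (K * 2 ^- n)
    (K * 2 `^ (n%:R * s + n%:R * e)).
Proof.
move=> a0 e0; have [L Lcount] := long_words_count c01 s_ge0 sum_s.
have [K1 K11 K1P] := poly_le_pow2 1 e0.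
have K10 : 0 <= K1 by apply: le_trans K11.
(* Then 2^-(q+1) < a, so the words of the tail have ratio above 2^-(n+q+1). *)
pose q := Num.truncn a^-1.
have qa : 2 ^- q.+1 < a.
  rewrite -[ltRHS]invrK ltf_pV2 ?posrE ?exprn_gt0 ?invr_gt0//.
  apply: lt_le_trans (truncnS_gt _) _.
  by rewrite -natrX ler_nat ltnW// ltn_expl.
apply: (coded_uniform (K1 := 2 * D)
  (K2 := L%:R * q.+1%:R * K1 * 2 `^ (q.+1%:R * s))).
- by move=> x.
- by move=> x; exact: powR_ge0.
move=> n; have [ws [wsP wsN]] := Lcount (n + q)%N.
have h : labelled (tail_params a n) (fun wz wz' => wz.1 = wz'.1)
    ((size ws)%:R : R).
  apply: (labelled_seq R (f := fst)) => wz [/andP[aw _] _]; apply: wsP.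
  apply: lt_le_trans aw; rewrite -addnS addnC exprD invfM.
  by rewrite ltr_pM2r.
apply: labelled_weaken h.
  move=> [w z] [w' z'] [/= /andP[_ wn] Fz] [/= _ Fz'] /= <-.
  rewrite /piece_map /= word_map_edist// mulrC ler_pM ?edist_ge0//.
  apply: le_trans (edist_triangle p _ _) _.
  by rewrite mulr_natl mulr2n lerD ?FC_bounded// edistC FC_bounded.
apply: le_trans wsN _.
rewrite (@le_trans _ _ (L%:R * (q.+1%:R * (K1 * 2 `^ (n%:R * e))) *
  2 `^ ((n + q).+1%:R * s)))//.
  rewrite ler_wpM2r ?powR_ge0// ler_wpM2l//.
  apply: (@le_trans _ _ (q.+1%:R * n.+1%:R)); last first.
    by rewrite ler_wpM2l//; have := K1P n; rewrite expr1.
  by rewrite -natrM ler_nat; nia.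
rewrite [leLHS](_ : _ = L%:R * q.+1%:R * K1 *
  (2 `^ (n%:R * e) * 2 `^ ((n + q).+1%:R * s))); last by ring.
rewrite -[leRHS]mulrA -!pow2D ler_wpM2l ?mulr_ge0// pow2_le//.
by rewrite -addnS natrD; lra.
Qed.

(** Each copy of F_C stays within D 2^-n of the point S_w(p) of F_0, so an enlarged cover of F_0 at
    this scale covers all copies. *)
Lemma tail_coded_base a e : 0 < e -> exists2 K : R, 1 <= K &
  forall n, coded (tail_params a n) piece_map (K * 2 ^- n)
    (K * 2 `^ (n%:R * alpha + n%:R * e)).
Proof.
move=> e0; have [K1 K11 K1F] := F0_coded e0.
apply: (coded_uniform (K1 := 2 * D + K1) (K2 := K1)).
- by move=> x.
- by move=> x; exact: powR_ge0.
move=> n; rewrite -mulrDr.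
have h := base_coded (tail_params a n) fst (K1F n).
apply: labelled_weaken h => //.
move=> [w z] [w' z'] [/= /andP[_ wn] Fz] [/= /andP[_ wn'] Fz'] ww'.
apply: le_trans (edist_triangle (S w p) _ _) _.
apply: (@le_trans _ _ (2 ^- n * D + (K1 * 2 ^- n + 2 ^- n * D))).
  rewrite lerD//.
    by rewrite /piece_map word_map_edist// ler_pM ?edist_ge0 ?FC_bounded.
  apply: le_trans (edist_triangle (S w' p) _ _) _; rewrite lerD//.
  by rewrite /piece_map word_map_edist// ler_pM ?edist_ge0// edistC FC_bounded.
by rewrite le_eqVlt; apply/orP; left; apply/eqP; ring.
Qed.

Lemma attractor_cover (a : R) n : 0 < a <= 1 -> (forall i, a <= c i) ->
  FC = \bigcup_(i in [set: I]) (simil (c i) (M i) (b i) @` FC) `|` C ->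
  FC `<=` \bigcup_(k in `I_n.+1) (piece_map @` piece_params k)
    `|` piece_map @` tail_params a n.
Proof.
move=> a01 ac FCE y Fy.
have n01 : 0 < (2 ^- n : R) <= 1.
  by rewrite pow2V_gt0//= invf_le1 ?exprn_gt0// exprn_ege1// ler1n.
have [w [[[x Cx ->] nw]|[[x Fx ->] wn]]] := attractor_stopping c01 FCE a01 ac n01 Fy.
  left; have [k [kw wk]] := words_k_exists c01 w.
  exists k; last by exists (w, x).
  rewrite /= ltnS leqNgt; apply/negP => nk.
  have := lt_le_trans nw wk; rewrite ltf_pV2 ?posrE ?exprn_gt0//.
  by rewrite ltr_eXn2l ?ltr1n// ltnNge (ltnW nk).
by right; exists (w, x).
Qed.

Lemma attractor_coded (a r e : R) : (0 < d)%N ->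
  0 < a <= 1 -> (forall i, a <= c i) ->
  FC = \bigcup_(i in [set: I]) (simil (c i) (M i) (b i) @` FC) `|` C ->
  (forall x, 0 <= x <= 1 -> bound_fun d s alpha beta gamma x <= r) -> 0 < e ->
  exists2 K : R, 1 <= K &
    forall n, coded FC id (K * 2 ^- n) (K * 2 `^ (n%:R * (r + e))).
Proof.
move=> d_gt0 a01 ac FCE br e0; have e20 : 0 < e / 2 by rewrite divr_gt0.
have a0 : 0 < a by case/andP: a01.
have [K1 K11 H1] := piece_coded_words e20.
have [K2 K21 H2] := piece_coded_ambient e20.
have [K3 K31 H3] := piece_coded_rotations d_gt0 e20.
have [K4 K41 H4] := piece_coded_linear e20.
have [K5 K51 H5] := tail_coded_words a0 e20.
have [K6 K61 H6] := tail_coded_base a e20.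
have [KP KP1 HP] := poly_le_pow2 1 e20.
pose K := K1 + K2 + K3 + K4 + K5 + K6.
have [] : [/\ [/\ K1 <= K, K2 <= K & K3 <= K], [/\ K4 <= K, K5 <= K & K6 <= K]
    & 1 <= K] by rewrite /K; split; [split|split|]; lra.
move=> [le1 le2 le3] [le4 le5 le6] leK.
have widen (A : set 'cV[R]_d) (Ki E : R) n : 1 <= Ki -> Ki <= K ->
    E <= n%:R * (r + e / 2) -> coded A id (Ki * 2 ^- n) (Ki * 2 `^ E) ->
    coded A id (K * 2 ^- n) (K * 2 `^ (n%:R * (r + e / 2))).
  move=> Ki1 KiK En; apply: coded_le; first by rewrite ler_wpM2r.
  by rewrite ler_pM ?powR_ge0 ?pow2_le// (le_trans _ Ki1).
have piece n k : (k <= n)%N -> coded (piece_map @` piece_params k) id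
    (K * 2 ^- n) (K * 2 `^ (n%:R * (r + e / 2))).
  move=> /subnKC; set j := (n - k)%N => <-.
  (* For N = 0 the quotient is 0 by convention, and N x = k still holds. *)
  pose N := (k + j)%:R : R; pose x := k%:R / N.
  have Nx : N * x = k%:R.
    rewrite /x /N; have [|nz] := eqVneq ((k + j)%:R : R) 0.
      move=> /eqP; rewrite pnatr_eq0 addn_eq0 => /andP[/eqP -> _].
      by rewrite mul0r mulr0.
    by rewrite mulrC divfK.
  have N1x : N * (1 - x) = j%:R by rewrite mulrBr Nx mulr1 /N natrD addrC addKr.
  have N0 : 0 <= N by rewrite /N.
  have x01 : 0 <= x <= 1.
    rewrite /x divr_ge0//=; have [->|nz] := eqVneq N 0; first by rewrite invr0 mulr0.
    by rewrite ler_pdivrMr ?mul1r ?lt_neqAle 1?eq_sym ?nz// /N ler_nat leq_addr.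
  have mulN f : f <= r -> N * f + N * (e / 2) <= N * (r + e / 2).
    by move=> fr; rewrite mulrDr lerD2r ler_wpM2l.
  (* A minimum is at most r as soon as one of the four terms is, and that term selects the cover
     used at this level. *)
  have := br x x01; rewrite /bound_fun !ge_min => /orP[]/orP[] /mulN fx.
  - apply: (widen _ K1 _ _ K11 le1 _ (coded_image (fun _ => id) (H1 (k, j)))).
    by apply: le_trans fx; rewrite /= -Nx -N1x lerD2r; lra.
  - apply: (widen _ K2 _ _ K21 le2 _ (coded_image (fun _ => id) (H2 (k, j)))).
    by apply: le_trans fx; rewrite /= -Nx -N1x lerD2r; lra.
  - apply: (widen _ K3 _ _ K31 le3 _ (coded_image (fun _ => id) (H3 (k, j)))).
    by apply: le_trans fx; rewrite /= -N1x lerD2r -/N; lra.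
  - apply: (widen _ K4 _ _ K41 le4 _ (coded_image (fun _ => id) (H4 (k, j)))).
    by apply: le_trans fx; rewrite /= -N1x -Nx lerD2r -/N; lra.
have tail n : coded (piece_map @` tail_params a n) id
    (K * 2 ^- n) (K * 2 `^ (n%:R * (r + e / 2))).
  have := br 1; rewrite ler01 lexx /bound_fun subrr !mul0r !addr0 !mul1r.
  have mulN f : f <= r -> n%:R * f + n%:R * (e / 2) <= n%:R * (r + e / 2).
    by move=> fr; rewrite mulrDr lerD2r ler_wpM2l.
  have sr : s <= r -> coded (piece_map @` tail_params a n) id
      (K * 2 ^- n) (K * 2 `^ (n%:R * (r + e / 2))).
    move=> /mulN sr.
    exact: (widen _ K5 _ _ K51 le5 sr (coded_image (fun _ => id) (H5 n))).
  have ar : alpha <= r -> coded (piece_map @` tail_params a n) id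
      (K * 2 ^- n) (K * 2 `^ (n%:R * (r + e / 2))).
    move=> /mulN ar.
    exact: (widen _ K6 _ _ K61 le6 ar (coded_image (fun _ => id) (H6 n))).
  move=> /(_ erefl); rewrite !ge_min => /orP[]/orP[] h.
  - exact: sr.
  - exact: ar.
  - exact: ar.
  - by apply: ar; apply: le_trans h; rewrite lerDl.
have K0 : 0 <= K by apply: le_trans leK.
have KP0 : 0 <= KP by apply: le_trans KP1.
have KKP : K <= 2 * KP * K by rewrite ler_peMl//; lra.
(* The n + 1 levels and the tail make n + 2 <= 2(n + 1) covers; the other half of the loss e bounds
   n + 1 by KP 2^(n e/2). *)
exists (2 * KP * K) => [|n]; first by apply: le_trans leK _.
have cov := attractor_cover n a01 ac FCE.
apply: coded_sub cov _.
have := coded_setU (coded_bigcup (fun k kn => piece n k kn)) (tail n).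
apply: coded_le; first by rewrite ler_wpM2r.
set B := K * _; have B0 : 0 <= B by rewrite mulr_ge0 ?powR_ge0.
have nKP : n.+1%:R <= KP * 2 `^ (n%:R * (e / 2)) by have := HP n; rewrite expr1.
have n1 : 1 <= n.+1%:R :> R by rewrite ler1n.
have -> : 2 * KP * K * 2 `^ (n%:R * (r + e)) = 2 * (KP * 2 `^ (n%:R * (e / 2))) * B.
  rewrite /B [RHS](_ : _ = 2 * KP * K *
    (2 `^ (n%:R * (e / 2)) * 2 `^ (n%:R * (r + e / 2)))); last by ring.
  by rewrite -pow2D; congr (_ * 2 `^ _); field.
rewrite -[X in _ + X]mul1r -mulrDl ler_wpM2r//; lra.
Qed.

End Pieces.

(** * The dimension bound *)

Lemma edist_dim0 (R : realType) (x y : 'cV[R]_0) : edist x y = 0.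
Proof. by rewrite /edist big_ord0 sqrtr0. Qed.

Lemma hdim_ge0 (R : realType) d (A : set 'cV[R]_d) : (0 <= hdim A)%E.
Proof. by apply: le_ereal_inf_tmp => _ [t [t0 _] <-]; rewrite lee_fin. Qed.

Theorem theorem4p8 (R : realType) (d : nat) (I : finType)
  (c : I -> R) (M : I -> 'M[R]_d) (b : I -> 'cV[R]_d)
  (C FC F0 : set 'cV[R]_d) (s alpha beta gamma : R) :
  (forall i, 0 < c i < 1) ->
  (forall i, orthogonal_mx (M i)) ->
  C !=set0 -> compact C ->
  FC !=set0 -> compact FC ->
  FC = \bigcup_(i in [set: I]) (simil (c i) (M i) (b i) @` FC) `|` C ->
  F0 !=set0 -> compact F0 ->
  F0 = \bigcup_(i in [set: I]) (simil (c i) (M i) (b i) @` F0) ->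
  0 <= s -> \sum_(i : I) c i `^ s = 1 ->
  hdim F0 = alpha%:E ->
  ubdim C = beta%:E ->
  0 <= gamma ->
  limn_esup (fun k : nat => ((count_lin c M k)%:R `^ (k%:R^-1))%:E) = (2 `^ gamma)%:E ->
  (ubdim FC <= ereal_sup [set (bound_fun d s alpha beta gamma x)%:E | x in [set x : R | (0 <= x <= 1)%R]])%E.
Proof.
move=> c01 oM C0 cC FC0 cFC FCE F00 cF0 F0E s0 sum_s hF0 bC gamma0 gammaE.
set E := ereal_sup _.
have bE x : 0 <= x <= 1 -> ((bound_fun d s alpha beta gamma x)%:E <= E)%E.
  by move=> x01; apply: ereal_sup_ubound; exists x.
have alpha0 : 0 <= alpha by rewrite -lee_fin -hF0 hdim_ge0.
have bE1 := bE 1; rewrite ler01 lexx in bE1; have {}bE1 := bE1 erefl.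
(* A supremum [+oo] leaves nothing to prove, and the value at x = 1 rules out [-oo]. *)
case EE : E bE bE1 => [r| |] bE bE1; [|exact: leey|by []].
have {}bE x : 0 <= x <= 1 -> bound_fun d s alpha beta gamma x <= r.
  by move=> /bE; rewrite lee_fin.
have r0 : 0 <= r.
  move: bE1; rewrite lee_fin; apply: le_trans; rewrite /bound_fun.
  by rewrite subrr !mul0r !addr0 !mul1r !le_min s0 alpha0 addr_ge0.
apply: coded_ubdim => // e e0.
(* In dimension 0 the exponent [d.-1] of the shells differs from d - 1; there a single label
   suffices. *)
have [d0|d_gt0] := posnP d.
  subst d; exists 1 => // n; exists unit, [:: tt], (fun=> tt); split => //=.
    rewrite mul1r -[leLHS](powRr0 2) pow2_le// mulr_ge0// addr_ge0//.
    exact: ltW.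
  by move=> x y _ _ _; rewrite edist_dim0 mul1r invr_ge0 exprn_ge0.
have [p F0p] := F00.
have [D1 D10 CD] := compact_edist_bounded p cC.
have [D2 D20 FCD] := compact_edist_bounded p cFC.
have [a a01 ac] := ratio_lb c01.
have F0_coded e' : 0 < e' -> exists2 K : R, 1 <= K &
    forall n, coded F0 id (K * 2 ^- n) (K * 2 `^ (n%:R * (alpha + e'))).
  move=> e'0; have : (hdim F0 < (alpha + e')%:E)%E by rewrite hF0 lte_fin ltrDl.
  move=> /ereal_inf_lt[_ [t [t0 ht] <-]]; rewrite lte_fin => ta.
  have [K K1 KF] := self_similar_coded c01 oM F00 cF0 F0E t0 ht.
  exists K => // n; apply: coded_le (KF n) => //.
  by rewrite le_const_pow2 ?(le_trans _ K1)// ler_wpM2l// ltW.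
have C_coded e' : 0 < e' -> exists2 K : R, 1 <= K &
    forall n, coded C id (2 ^- n) (K * 2 `^ (n%:R * (beta + e'))).
  by move=> e'0; apply: ubdim_coded bC _; rewrite ?ltrDl.
have count_le e' : 0 < e' -> exists2 K : R, 1 <= K &
    forall k, (count_lin c M k)%:R <= K * 2 `^ (k%:R * (gamma + e')).
  move=> e'0; apply: limn_esup_root_le gammaE _ _ => //.
    by rewrite addr_ge0// ltW.
  by rewrite ltrDl.
apply: (@attractor_coded R d I c M b c01 oM s alpha beta gamma s0 sum_s gamma0
  C F0 p (D1 + D2) F0p _ _ _ F0_coded C_coded count_le FC _ a) => //.
- by rewrite -F0E.
- by rewrite addr_gt0.
- by move=> z /CD; rewrite edistC; move=> /le_trans; apply; rewrite lerDl ltW.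
- by move=> z /FCD; rewrite edistC; move=> /le_trans; apply; rewrite lerDr ltW.
Qed.
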